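(* Let $s \geq 3$ be a natural number, let $\psi(x)$ be a polynomial with real coefficients and degree $d \geq 2$, and let $A$ be a finite, non-empty subset of real numbers. Then $$E_{s,2}(A) \ll_{d,s} |A|^{2s-3+\eta_s},$$ where $\eta_3 = 1/2$, and $\eta_s = (1/4 - 1/7246)\cdot 2^{-s+4}$ for $s \geq 4$.
   Context: $E_{s,2}(A)$ denotes the number of $2s$-tuples $(x_1,\dots,x_{2s}) \in A^{2s}$ satisfying $$\sum_{i=1}^{s} (\psi(x_i) - \psi(x_{i+s})) = \sum_{i=1}^{s} (x_i - x_{i+s}) = 0.$$ The notation $X \ll_{d,s} Y$ means $|X| \leq K |Y|$ for some constant $K>0$ depending only on $d$ and $s$ (in particular not on the coefficients of $\psi$ nor on $A$). *)

(* Defs.v *)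
From HB Require Import structures.
From mathcomp Require Import all_boot all_order all_algebra.
From mathcomp Require Import finmap.
From mathcomp Require Import reals exp.

Set Implicit Arguments.
Unset Strict Implicit.
Unset Printing Implicit Defensive.

Import Order.TTheory GRing.Theory Num.Theory.
Local Open Scope ring_scope.

(* With 0-based indices, [x (lshift s i)] is x_i and [x (rshift s i)] is
   x_{i+s}. *)
Definition energy2 (R : realType) (s : nat) (psi : {poly R}) (A : {fset R})
    : nat :=
  #|[set x : {ffun 'I_(s + s) -> A} |
      (\sum_(i < s) (psi.[val (x (lshift s i))] - psi.[val (x (rshift s i))])
         == 0)
   && (\sum_(i < s) (val (x (lshift s i)) - val (x (rshift s i))) == 0)]|.

(* Only used for 3 <= s. *)
Definition eta_s (R : realType) (s : nat) : R :=
  if s == 3%N then 1 / 2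
  else (1 / 4 - 1 / 7246) * 2 ^ (- s%:Z + 4).

(* Main.v *)
Require Import Defs.
From HB Require Import structures.
From mathcomp Require Import all_boot all_order all_algebra.
From mathcomp Require Import finmap.
From mathcomp Require Import reals exp.
From mathcomp Require Import boolp polyrcf.
From mathcomp Require Import zify ring lra.

(** Let [P] be the part over [A] of the graph of [psi], [N] its size, and [E_s]
    the additive energy of the [s]-fold sumset of [P] with multiplicity.
    Between two roots of [psi''] the graph is strictly convex or concave, so two
    translates of such an arc differ by a monotone function and meet at most
    once; a Szemeredi-Trotter bound for them follows from a crossing inequality
    whose planar case only uses the order of the line.  Weighted by
    multiplicities and summed over level sets it gives
    [E_(s+1) << N^s (N E_s)^(1/2) + N^(1+o(1)) E_s], hence
    [E_3 << N^(7/2)] from [E_2 << N^2], and the passage from [s] to [s + 1]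
    for [s >= 4].

    For [s = 4] this falls short of the claim.  With [S = P + P] and [r(t)] the
    number of representations of [t] in [S - S], the matrix [r(s - t)] on
    [S x S] is positive semidefinite, so (Shkredov)
    [(E_4 / N^2)^3 <= tr r^3 <= (sum r^3)^(1/2) (sum r(a)^2 r(b)^2 r(a+b)^2)^(1/2)];
    the incidence bound controls the third moment of [r] and, applied to
    the dyadic level sets [T] of [r], the energies of [T + S] which
    dominate the last sum.  This yields [E_4 << N^(131/25)], and
    [131/25 < 5 + 1/4 - 1/7246]. *)

Set Implicit Arguments.
Unset Strict Implicit.
Unset Printing Implicit Defensive.

Import Order.TTheory GRing.Theory Num.Theory.
Local Open Scope ring_scope.

(** * Arrangements of monotonically crossing curves *)


(** Write the bound as E_s << N^(2s-3+eta). One incidence step turns eta into eta/2, because s +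
    (2s-3+eta+1)/2 = 2(s+1)-3+eta/2; this is the origin of the factor 2^(-s+4). Starting from eta =
    1/2 at s = 3 it gives exactly 1/4 at s = 4, so a saving has to be won once, at s = 4, and is
    inherited afterwards. At s = 4 the third moment of r is about N^(13/2), and a level T of height
    D satisfies |T| D^3 << N^(13/2). Cut the last sum of the trace inequality at height N^delta: the
    low part is at most about N^(2 delta) E_4^2, the high part about N^(105/8 - delta/4). The
    resulting exponents of E_4 are (37/2 + 2 delta)/4 and (253/8 - delta/4)/6, which balance near
    delta = 1.19. The convenient value delta = 9/8 gives 83/16 and 1003/192; both lie below 131/25,
    which leaves room for the logarithms. The constants are uniform because the polynomial enters
    only through its degree, which bounds the number of arcs and of solutions of a shift
    equation. *)

Lemma card_colorings (V : finType) (k : nat) (S : {set V}) :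
  (#|[set x : {ffun V -> 'I_k.+1} | [forall v in S, x v == ord0]]|
     * k.+1 ^ #|S| = k.+1 ^ #|V|)%N.
Proof.
have -> : #|[set x : {ffun V -> 'I_k.+1} | [forall v in S, x v == ord0]]| =
    (\sum_(x : {ffun V -> 'I_k.+1})
      \prod_v (if v \in S then (x v == ord0 : nat) else 1))%N.
  rewrite -sum1_card big_mkcond /=; apply: eq_bigr => x _; rewrite inE.
  case: ifP => [/forall_inP h|/negbT/forall_inPn[v vS /negbTE h]].
    by rewrite big1 // => v _; case: ifP => // /h ->.
  by rewrite (bigD1 v) //= vS h.
rewrite -(bigA_distr_bigA (fun v j => if v \in S then (j == ord0 : nat) else 1)%N).
rewrite -(cardC S) expnD -(mulnC (k.+1 ^ _)%N); congr (_ * _)%N.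
rewrite (bigID (mem S)) /= big1 ?mul1n; last first.
  move=> v vS; rewrite vS (bigD1 ord0) //= big1 // => j /negbTE.
  by move=> ->.
rewrite -prod_nat_const; apply: eq_big => v; first by rewrite !inE.
by move/negbTE=> ->; rewrite sum1_card card_ord.
Qed.

Lemma sum_card_set (T I : finType) (A : {set T}) (P : I -> T -> bool) :
  (\sum_(i : I) #|[set t in A | P i t]| = \sum_(t in A) #|[set i | P i t]|)%N.
Proof.
under eq_bigr do rewrite -sum1_card big_mkcond /=.
under [RHS]eq_bigr do rewrite -sum1_card big_mkcond /=.
rewrite exchange_big /= [RHS]big_mkcond /=; apply: eq_bigr => t _.
case: ifP => tA; last by rewrite big1 // => i _; rewrite inE tA.
by apply: eq_bigr => i _; rewrite !inE tA.
Qed.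

Section Arrangement.
Variables (R : realFieldType) (V C : finType) (px py : V -> R).
Hypothesis pinj : forall u v, px u = px v -> py u = py v -> u = v.
Variables (dom : C -> R -> bool) (val : C -> R -> R) (key : C -> R).
Hypothesis dom_conv : forall c x y z,
  dom c x -> dom c z -> x <= y -> y <= z -> dom c y.
(** [key] plays the role of a slope: the curve with the smaller key rises faster, and curves with
    equal keys are vertical translates of each other. *)
Hypothesis val_mono : forall c c' x y, key c < key c' ->
  dom c x -> dom c y -> dom c' x -> dom c' y -> x < y ->
  val c x - val c' x < val c y - val c' y.
Hypothesis val_par : forall c c' x y, key c = key c' ->
  dom c x -> dom c y -> dom c' x -> dom c' y ->
  val c x - val c' x = val c y - val c' y.
Hypothesis val_par_inj : forall c c' x, key c = key c' ->
  dom c x -> dom c' x -> val c x = val c' x -> c = c'.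

Definition on (c : C) (v : V) := dom c (px v) && (val c (px v) == py v).

Definition edge := (C * V * V)%type.
Implicit Types e f g : edge.
Definition crv e := e.1.1.
Definition lft e := e.1.2.
Definition rgt e := e.2.
Definition xl e := px (lft e).
Definition xr e := px (rgt e).
Definition fe e := val (crv e).

Lemma edgeE e : e = (crv e, lft e, rgt e).
Proof. by case: e => [[]]. Qed.

Definition in_range e x := (xl e <= x) && (x <= xr e).

(** A crossing is a change of order between two common abscissas, so that neither continuity nor an
    intersection point is involved. *)
Definition cross e f := exists x y,
  [/\ in_range e x, in_range e y, in_range f x & in_range f y] /\
  (fe e x < fe f x) && (fe f y < fe e y).

Lemma crossC e f : cross e f -> cross f e.
Proof.
by case=> x [y [[a b c d] /andP[h1 h2]]]; exists y, x; split=> //; apply/andP.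
Qed.

(** * Families of arcs without crossings *)

Section Planar.
Variables (W : {set V}) (E : {set edge}).
Hypothesis E_W : forall e, e \in E -> (lft e \in W) && (rgt e \in W).
Hypothesis E_on : forall e, e \in E -> on (crv e) (lft e) /\ on (crv e) (rgt e).
Hypothesis E_lt : forall e, e \in E -> xl e < xr e.
Hypothesis E_free : forall e v, e \in E -> xl e < px v -> px v < xr e ->
  fe e (px v) != py v.
Hypothesis E_nc : forall e f, e \in E -> f \in E -> ~ cross e f.

Lemma nc_le e f x y : e \in E -> f \in E ->
  in_range e x -> in_range e y -> in_range f x -> in_range f y ->
  fe e x < fe f x -> fe e y <= fe f y.
Proof.
move=> eE fE ex ey fx fy lt; rewrite leNgt; apply/negP=> lt'.
by apply: (E_nc eE fE); exists x, y; rewrite lt lt'.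
Qed.

Lemma fe_l e : e \in E -> fe e (xl e) = py (lft e).
Proof. by case/E_on => /andP[_ /eqP h] _. Qed.

Lemma fe_r e : e \in E -> fe e (xr e) = py (rgt e).
Proof. by case/E_on => _ /andP[_ /eqP h]. Qed.

Lemma in_l e : e \in E -> in_range e (xl e).
Proof. by move=> eE; rewrite /in_range lexx ltW // E_lt. Qed.

Lemma in_r e : e \in E -> in_range e (xr e).
Proof. by move=> eE; rewrite /in_range lexx ltW // E_lt. Qed.

Lemma in_dom e x : e \in E -> in_range e x -> dom (crv e) x.
Proof.
move=> eE /andP[a b]; have [/andP[dl _] /andP[dr _]] := E_on eE.
exact: dom_conv dl dr a b.
Qed.

Lemma mono_e e f x y : e \in E -> f \in E -> key (crv e) < key (crv f) ->
  in_range e x -> in_range e y -> in_range f x -> in_range f y -> x < y ->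
  fe e x - fe f x < fe e y - fe f y.
Proof. by move=> eE fE k *; apply: val_mono; rewrite ?in_dom. Qed.

Lemma key_neq e f x : e \in E -> f \in E -> in_range e x -> in_range f x ->
  fe e x = fe f x -> key (crv e) = key (crv f) -> crv e = crv f.
Proof. by move=> eE fE ex fx h k; apply: val_par_inj k _ _ h; rewrite in_dom. Qed.

Lemma same_crv_l e f : e \in E -> f \in E -> crv e = crv f -> lft e = lft f ->
  e = f.
Proof.
move=> eE fE ec el.
have er : rgt e = rgt f.
  case: (ltgtP (xr e) (xr f)) => h.
  - have /(_ _)/negP[] := E_free (v := rgt e) fE _ h.
      by rewrite /xl -el; apply: E_lt.
    by rewrite /fe -ec; case: (E_on eE) => _ /andP[].
  - have /(_ _)/negP[] := E_free (v := rgt f) eE _ h.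
      by rewrite /xl el; apply: E_lt.
    by rewrite /fe ec; case: (E_on fE) => _ /andP[].
  - by apply: pinj => //; rewrite -(fe_r eE) -(fe_r fE) h /fe ec.
by rewrite (edgeE e) (edgeE f) ec el er.
Qed.

Lemma same_crv_r e f : e \in E -> f \in E -> crv e = crv f -> rgt e = rgt f ->
  e = f.
Proof.
move=> eE fE ec er; apply: same_crv_l => //.
case: (ltgtP (xl e) (xl f)) => h.
- have /(_ _)/negP[] := E_free (v := lft f) eE h.
    by rewrite /xr er; apply: E_lt.
  by rewrite /fe ec; case: (E_on fE) => /andP[].
- have /(_ _)/negP[] := E_free (v := lft e) fE h.
    by rewrite /xr -er; apply: E_lt.
  by rewrite /fe -ec; case: (E_on eE) => /andP[].
- by apply: pinj => //; rewrite -(fe_l eE) -(fe_l fE) h /fe ec.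
Qed.

(* Edges leaving a common point are ordered by height exactly as by [key] to
   its right, and in the opposite order to its left. *)
Lemma above_r e f x : e \in E -> f \in E -> lft e = lft f ->
  key (crv e) < key (crv f) -> in_range e x -> in_range f x -> xl e < x ->
  fe f x < fe e x.
Proof.
move=> eE fE el k ex fx lx.
have xlE : xl f = xl e by rewrite /xl el.
have := mono_e eE fE k (in_l eE) ex _ fx lx.
rewrite -xlE in_l // => /(_ isT).
by rewrite {1}xlE (fe_l eE) (fe_l fE) el subrr subr_gt0.
Qed.

Lemma above_l e f x : e \in E -> f \in E -> rgt e = rgt f ->
  key (crv e) < key (crv f) -> in_range e x -> in_range f x -> x < xr e ->
  fe e x < fe f x.
Proof.
move=> eE fE el k ex fx lx.
have xlE : xr f = xr e by rewrite /xr el.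
have := mono_e eE fE k ex (in_r eE) fx _ lx.
rewrite -xlE in_r // => /(_ isT).
by rewrite {1}xlE (fe_r eE) (fe_r fE) el subrr subr_lt0.
Qed.


(** The edges above [e] that share its left end, respectively its right end: by [above_r] a smaller
    key is higher to the right of a common point, by [above_l] a larger key is higher to the
    left. *)
Definition upR e := [set f in E | (lft f == lft e) && (key (crv f) < key (crv e))].
Definition upL e := [set f in E | (rgt f == rgt e) && (key (crv e) < key (crv f))].

Lemma key_inj_l e f : e \in E -> f \in E -> lft e = lft f ->
  key (crv e) = key (crv f) -> e = f.
Proof.
move=> eE fE el k; apply: same_crv_l => //.
have xlE : xl e = xl f by rewrite /xl el.
apply: (key_neq (x := xl e) eE fE) => //; first exact: in_l.
  by rewrite xlE in_l.
by rewrite {2}xlE !fe_l // el.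
Qed.

Lemma key_inj_r e f : e \in E -> f \in E -> rgt e = rgt f ->
  key (crv e) = key (crv f) -> e = f.
Proof.
move=> eE fE el k; apply: same_crv_r => //.
have xlE : xr e = xr f by rewrite /xr el.
apply: (key_neq (x := xr e) eE fE) => //; first exact: in_r.
  by rewrite xlE in_r.
by rewrite {2}xlE !fe_r // el.
Qed.

Lemma card_topR : (#|[set e in E | upR e == set0]| <= #|W|)%N.
Proof.
rewrite -(card_in_imset (f := lft)).
  apply/subset_leq_card/subsetP => _ /imsetP[e + ->].
  by rewrite inE => /andP[/E_W/andP[]].
move=> e f; rewrite !inE => /andP[eE /eqP e0] /andP[fE /eqP f0] ef.
apply: key_inj_l => //; case: (ltgtP (key (crv e)) (key (crv f))) => // k.
  by have := in_set0 e; rewrite -f0 inE eE ef eqxx k.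
by have := in_set0 f; rewrite -e0 inE fE ef eqxx k.
Qed.

Lemma card_topL : (#|[set e in E | upL e == set0]| <= #|W|)%N.
Proof.
rewrite -(card_in_imset (f := rgt)).
  apply/subset_leq_card/subsetP => _ /imsetP[e + ->].
  by rewrite inE => /andP[/E_W/andP[]].
move=> e f; rewrite !inE => /andP[eE /eqP e0] /andP[fE /eqP f0] ef.
apply: key_inj_r => //; case: (ltgtP (key (crv e)) (key (crv f))) => // k.
  by have := in_set0 f; rewrite -e0 inE fE ef eqxx k.
by have := in_set0 e; rewrite -f0 inE eE ef eqxx k.
Qed.

(** [e] is met first when going straight down from the vertex [v]. The ranges are open, so edges
    that merely end at the abscissa of [v] do not count. *)
Definition sees e v := [&& (v \in W) && (xl e < px v), px v < xr e, fe e (px v) < py v &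
  [forall f in E, ~~ [&& xl f < px v, px v < xr f, fe e (px v) < fe f (px v)
                     & fe f (px v) < py v]]].

(** Two edges seen from [v] have the same height there. Different keys would make their difference
    change sign at [v], which is a crossing; equal keys put them on one curve, where [E_free] leaves
    only one edge over that abscissa. *)
Lemma sees_inj e f v : e \in E -> f \in E -> sees e v -> sees f v -> e = f.
Proof.
move=> eE fE /and4P[/andP[_ e1] e2 e3 /forall_inP e4].
case/and4P => /andP[_ f1] f2 f3 /forall_inP f4.
have ex x : xl e <= x -> x <= xr e -> in_range e x by move=> *; apply/andP.
have fx x : xl f <= x -> x <= xr f -> in_range f x by move=> *; apply/andP.
case: (ltgtP (fe e (px v)) (fe f (px v))) => h.
- by have := e4 _ fE; rewrite f1 f2 h f3.
- by have := f4 _ eE; rewrite e1 e2 h e3.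
have ev : in_range e (px v) by rewrite ex // ltW.
have fv : in_range f (px v) by rewrite fx // ltW.
pose a := Order.max (xl e) (xl f); pose b := Order.min (xr e) (xr f).
have av : a < px v by rewrite gt_max e1 f1.
have vb : px v < b by rewrite lt_min e2 f2.
have ab : a < b by apply: lt_trans vb.
have [ea fa eb fb] : [/\ in_range e a, in_range f a, in_range e b & in_range f b].
  have : [/\ xl e <= a, xl f <= a, b <= xr e & b <= xr f].
    by rewrite /a /b !le_max !ge_min !lexx !orbT.
  case=> h1 h2 h3 h4; have h5 := ltW ab.
  by split; rewrite /in_range ?h1 ?h2 ?h3 ?h4 ?(le_trans _ h3) ?(le_trans _ h4)
     ?(le_trans h1) ?(le_trans h2).
have key_case e' f' : e' \in E -> f' \in E -> in_range e' a -> in_range e' b ->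
    in_range f' a -> in_range f' b -> in_range e' (px v) -> in_range f' (px v) ->
    fe e' (px v) = fe f' (px v) -> key (crv e') < key (crv f') -> False.
  move=> e'E f'E ea' eb' fa' fb' ev' fv' h' k.
  apply: (E_nc e'E f'E); exists a, b; split=> //.
  have := mono_e e'E f'E k ea' ev' fa' fv' av.
  have := mono_e e'E f'E k ev' eb' fv' fb' vb.
  by rewrite h' subrr subr_gt0 subr_lt0 => -> ->.
case: (ltgtP (key (crv e)) (key (crv f))) => k.
- by case: (key_case e f).
- by case: (key_case f e).
have cE := key_neq eE fE ev fv h k.
have lE : xl e = xl f.
  case: (ltgtP (xl e) (xl f)) => // l.
    have := E_free (v := lft f) eE l (lt_trans f1 e2).
    by rewrite /fe cE -/(xl f) -/(fe f _) fe_l // eqxx.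
  have := E_free (v := lft e) fE l (lt_trans e1 f2).
  by rewrite /fe -cE -/(xl e) -/(fe e _) fe_l // eqxx.
apply: same_crv_l => //; apply: pinj => //.
by rewrite -!fe_l // lE /fe cE.
Qed.

(* Below the next edge [f] above [e] at their common left end, the leftmost
   vertex above [e] sees [e]: an edge in between would start further left. *)
Lemma sees_descend_l e f v0 : e \in E -> f \in upR e ->
  (forall g, g \in upR e -> key (crv g) <= key (crv f)) ->
  [&& (v0 \in W) && (xl e < px v0), px v0 < xr e, px v0 <= xr f, fe e (px v0) < py v0
    & py v0 <= fe f (px v0)] ->
  exists v, sees e v.
Proof.
move=> eE; rewrite inE => /and3P[fE /eqP fl kf] fmax Pv0.
case: (arg_minP (P := fun v => [&& (v \in W) && (xl e < px v), px v < xr e, px v <= xr f,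
  fe e (px v) < py v & py v <= fe f (px v)]) px Pv0) => v /and5P[/andP[vW v1] v2 v3 v4 v5] vmin.
exists v; apply/and4P; rewrite vW; split=> //; apply/forall_inP => g gE.
apply/negP => /and4P[g1 g2 g3 g4].
have flE : xl f = xl e by rewrite /xl fl.
have ir h x : xl h <= x -> x <= xr h -> in_range h x by move=> *; apply/andP.
have [ev gv fv] : [/\ in_range e (px v), in_range g (px v) & in_range f (px v)].
  by split; apply: ir => //; rewrite ?flE // ltW.
have gf := lt_le_trans g4 v5.
(* Three ways for an edge [g] to lie between [e] and [v]. Starting left of [e], it is squeezed
   between [e] and [f] through the vertex [lft e], against [E_free]. Starting further right, its
   left end is an earlier candidate. Starting level, it leaves [lft e] with a key strictly between
   those of [f] and [e]. *)
case: (ltgtP (xl g) (xl e)) => l.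
- have ge : in_range g (xl e) by rewrite ir // ltW // (lt_trans v1).
  have fe_ : in_range f (xl e) by rewrite -flE in_l.
  have h1 := nc_le eE gE ev (in_l eE) gv ge g3.
  have := nc_le gE fE gv ge fv fe_ gf.
  rewrite -{2}flE fe_l // fl -fe_l // => h2.
  have /negP[] := E_free (v := lft e) gE l (lt_trans v1 g2).
  by rewrite -/(xl e) -fe_l //; apply/eqP/le_anti; rewrite h1 h2.
- have eg : in_range e (xl g) by rewrite ir // ltW // (lt_trans _ v2).
  have fg : in_range f (xl g).
    by rewrite ir // ?flE; [exact: ltW | apply: le_trans v3; exact: ltW].
  have h1 := nc_le eE gE ev eg gv (in_l gE) g3.
  have h2 := nc_le gE fE gv (in_l gE) fv fg gf.
  have /negP[] : ~~ (px v <= px (lft g)) by rewrite -ltNge.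
  have /andP[lW rW] := E_W gE.
  apply: vmin; apply/and5P; rewrite ?lW ?rW; split => //.
  + exact: lt_trans v2.
  + by apply: le_trans v3; exact: ltW.
  + rewrite lt_neqAle -{2}fe_l // h1 andbT.
    by apply: E_free => //; apply: lt_trans v2.
  + by rewrite -fe_l.
have fe_ : in_range f (xl g) by rewrite l -flE in_l.
have eg : in_range e (xl g) by rewrite l in_l.
have h1 := nc_le eE gE ev eg gv (in_l gE) g3.
have h2 := nc_le gE fE gv (in_l gE) fv fe_ gf.
have gl : lft g = lft e.
  apply: pinj => //; rewrite -fe_l //; apply/le_anti/andP; split.
    by apply: (le_trans h2); rewrite l -flE fe_l // fl.
  by rewrite -(fe_l eE) -l.
have k1 : key (crv g) < key (crv e).
  case: (ltgtP (key (crv g)) (key (crv e))) => // k.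
    by have := above_r eE gE (esym gl) k ev gv v1; rewrite ltNge ltW.
  by move: g3; rewrite (key_inj_l gE eE gl k) ltxx.
have := fmax g; rewrite inE gE gl eqxx k1 => /(_ isT).
rewrite le_eqVlt => /orP[/eqP k|k].
  by move: gf; rewrite (key_inj_l gE fE _ k) ?ltxx // gl fl.
have := above_r gE fE _ k gv fv; rewrite gl fl l => /(_ erefl v1).
by rewrite ltNge ltW.
Qed.

(** Mirror image of [sees_descend_l]: here the rightmost candidate sees [e]. *)
Lemma sees_descend_r e f v0 : e \in E -> f \in upL e ->
  (forall g, g \in upL e -> key (crv f) <= key (crv g)) ->
  [&& (v0 \in W) && (xl e < px v0), px v0 < xr e, xl f <= px v0, fe e (px v0) < py v0
    & py v0 <= fe f (px v0)] ->
  exists v, sees e v.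
Proof.
move=> eE; rewrite inE => /and3P[fE /eqP fl kf] fmax Pv0.
case: (arg_maxP (P := fun v => [&& (v \in W) && (xl e < px v), px v < xr e, xl f <= px v,
  fe e (px v) < py v & py v <= fe f (px v)]) px Pv0) => v /and5P[/andP[vW v1] v2 v3 v4 v5] vmin.
exists v; apply/and4P; rewrite vW; split=> //; apply/forall_inP => g gE.
apply/negP => /and4P[g1 g2 g3 g4].
have flE : xr f = xr e by rewrite /xr fl.
have ir h x : xl h <= x -> x <= xr h -> in_range h x by move=> *; apply/andP.
have [ev gv fv] : [/\ in_range e (px v), in_range g (px v) & in_range f (px v)].
  by split; apply: ir => //; rewrite ?flE // ltW.
have gf := lt_le_trans g4 v5.
case: (ltgtP (xr g) (xr e)) => l.
- have eg : in_range e (xr g) by rewrite ir // ltW // (lt_trans v1).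
  have fg : in_range f (xr g).
    by rewrite ir // ?flE; [apply: (le_trans v3); exact: ltW | exact: ltW].
  have h1 := nc_le eE gE ev eg gv (in_r gE) g3.
  have h2 := nc_le gE fE gv (in_r gE) fv fg gf.
  have /negP[] : ~~ (px (rgt g) <= px v) by rewrite -ltNge.
  have /andP[lW rW] := E_W gE.
  apply: vmin; apply/and5P; rewrite ?lW ?rW; split => //.
  + exact: (lt_trans v1).
  + by apply: (le_trans v3); exact: ltW.
  + rewrite lt_neqAle -{2}fe_r // h1 andbT.
    by apply: E_free => //; apply: (lt_trans v1).
  + by rewrite -fe_r.
- have ge : in_range g (xr e) by rewrite ir // ltW // (lt_trans _ v2).
  have fe_ : in_range f (xr e) by rewrite -flE in_r.
  have h1 := nc_le eE gE ev (in_r eE) gv ge g3.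
  have := nc_le gE fE gv ge fv fe_ gf.
  rewrite -{2}flE fe_r // fl -fe_r // => h2.
  have /negP[] := E_free (v := rgt e) gE (lt_trans g1 v2) l.
  by rewrite -/(xr e) -fe_r //; apply/eqP/le_anti; rewrite h1 h2.
have fe_ : in_range f (xr g) by rewrite l -flE in_r.
have eg : in_range e (xr g) by rewrite l in_r.
have h1 := nc_le eE gE ev eg gv (in_r gE) g3.
have h2 := nc_le gE fE gv (in_r gE) fv fe_ gf.
have gl : rgt g = rgt e.
  apply: pinj => //; rewrite -fe_r //; apply/le_anti/andP; split.
    by apply: (le_trans h2); rewrite l -flE fe_r // fl.
  by rewrite -(fe_r eE) -l.
have k1 : key (crv e) < key (crv g).
  case: (ltgtP (key (crv e)) (key (crv g))) => // k.
    have := above_l gE eE gl k gv ev; rewrite l => /(_ v2).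
    by rewrite ltNge ltW.
  by move: g3; rewrite (key_inj_r gE eE gl (esym k)) ltxx.
have := fmax g; rewrite inE gE gl eqxx k1 => /(_ isT).
rewrite le_eqVlt => /orP[/eqP k|k].
  by move: gf; rewrite (key_inj_r gE fE _ (esym k)) ?ltxx // gl fl.
have := above_l fE gE _ k fv gv; rewrite gl fl flE => /(_ erefl v2).
by rewrite ltNge ltW.
Qed.

Lemma sees_exists e : e \in E -> upR e != set0 -> upL e != set0 ->
  exists v, sees e v.
Proof.
move=> eE /set0Pn[f0 f0R] /set0Pn[g0 g0L].
case: (arg_maxP (P := mem (upR e)) (fun f => key (crv f)) f0R) => f fR fmax.
have {}fR : f \in upR e by [].
have := fR; rewrite inE => /and3P[fE /eqP fl kf].
have flE : xl f = xl e by rewrite /xl fl.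
(* If [f], the next edge above [e] at the left, stops short of [e], then its right end is a
   candidate. *)
case: (ltP (xr f) (xr e)) => l.
  have /andP[_ rW] := E_W fE.
  apply: (sees_descend_l (v0 := rgt f) eE fR fmax); rewrite rW.
  have lx : xl e < xr f by rewrite -flE E_lt.
  rewrite -/(xr f) lx l lexx -fe_r // lexx !andbT /=.
  by apply: above_r => //; [exact: in_r | rewrite /in_range !ltW | rewrite flE].
case: (arg_minP (P := mem (upL e)) (fun f => key (crv f)) g0L) => g gL gmin.
have {}gL : g \in upL e by [].
have := gL; rewrite inE => /and3P[gE /eqP gl kg].
have glE : xr g = xr e by rewrite /xr gl.
have fr : in_range f (xr e) by rewrite /in_range flE l ltW // E_lt.
have f_above : fe e (xr e) < fe f (xr e).
  by apply: above_r => //; rewrite ?in_r ?flE ?E_lt.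
(* Now [f] spans the range of [e]. If [g] did so too, it would lie above the common left end of [e]
   and [f] and yet below [f] at [xr e], hence cross [f]. So [g] starts inside, and its left end is a
   candidate. *)
have lx : xl e < xl g.
  rewrite ltNge; apply/negP=> l'.
  have gle : in_range g (xl e) by rewrite /in_range l' glE ltW ?E_lt.
  have h1 : fe e (xl e) < fe g (xl e).
    by apply: above_l => //; rewrite ?in_l ?E_lt.
  have h2 : fe g (xr e) < fe f (xr e).
    by rewrite -{1}glE fe_r // gl -fe_r.
  have fle : in_range f (xl e) by rewrite -flE in_l.
  have gre : in_range g (xr e) by rewrite -glE in_r.
  have := nc_le gE fE gre gle fr fle h2.
  by rewrite -{2}flE fe_l // fl -fe_l // leNgt h1.
have gx : xl g < xr e by rewrite -glE E_lt.
have /andP[lW _] := E_W gE.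
apply: (sees_descend_r (v0 := lft g) eE gL gmin); rewrite lW.
rewrite -/(xl g) lx gx lexx -fe_l // lexx !andbT /=.
by apply: above_l => //; rewrite ?in_l // /in_range !ltW.
Qed.

(** A substitute for Euler's formula: an edge is uppermost at its left end, uppermost at its right
    end, or seen from above by some vertex, and each of the three kinds injects into [W]. *)
Lemma planar_bound : (#|E| <= 3 * #|W|)%N.
Proof.
pose S := [set e in E | [exists v, sees e v]].
have cS : (#|S| <= #|W|)%N.
  have h e : e \in S -> exists v, sees e v by rewrite inE => /andP[_ /existsP].
  pose F e := odflt (lft e) [pick v | sees e v].
  have FP e : e \in S -> sees e (F e).
    move=> /h[v sv]; rewrite /F; case: pickP => //= n; by rewrite n in sv.
  rewrite -(card_in_imset (f := F)).
    apply/subset_leq_card/subsetP => _ /imsetP[e + ->].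
    by move=> /FP/and4P[/andP[]].
  move=> e f eS fS ef; have := FP _ fS; rewrite -ef => sf.
  apply: (@sees_inj _ _ (F e)) => //; [| |exact: FP].
    by move: eS; rewrite inE => /andP[].
  by move: fS; rewrite inE => /andP[].
have sub : E \subset [set e in E | upR e == set0] :|: [set e in E | upL e == set0] :|: S.
  apply/subsetP => e eE; rewrite !inE eE /=.
  case: eqVneq => //= r; case: eqVneq => //= l.
  by apply/existsP/sees_exists.
apply: leq_trans (subset_leq_card sub) _.
apply: leq_trans (leq_card_setU _ _) _.
apply: leq_trans (leq_add (leq_card_setU _ _) (leqnn _)) _.
have := card_topR; have := card_topL; lia.
Qed.

End Planar.

(** * Counting crossings *)

Definition arc e := [&& on (crv e) (lft e), on (crv e) (rgt e), xl e < xr e &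
  [forall v, (xl e < px v) && (px v < xr e) ==> (fe e (px v) != py v)]].

Definition crossings (E : {set edge}) :=
  [set ef : edge * edge | [&& ef.1 \in E, ef.2 \in E & `[< cross ef.1 ef.2 >]]].

(** The edges that cross nothing form a planar family; all others occur as first components of the
    ordered pairs in [crossings]. *)
Lemma crossing_excess (W : {set V}) (E : {set edge}) :
  (forall e, e \in E -> arc e) ->
  (forall e, e \in E -> (lft e \in W) && (rgt e \in W)) ->
  (#|E| <= 3 * #|W| + #|crossings E|)%N.
Proof.
move=> Earc EW.
pose E0 := [set e in E | [forall f in E, ~~ `[< cross e f >]]].
have h0 : (#|E0| <= 3 * #|W|)%N.
  have E0E e : e \in E0 -> e \in E by rewrite inE => /andP[].
  apply: planar_bound.
  - by move=> e /E0E/EW.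
  - by move=> e /E0E/Earc/and4P[].
  - by move=> e /E0E/Earc/and4P[].
  - move=> e v /E0E/Earc/and4P[_ _ _ /forallP h] a b.
    by have /implyP := h v; rewrite a b; apply.
  - move=> e f; rewrite inE => /andP[_ /forall_inP h] /E0E fE cr.
    by have /negP[] := h _ fE; apply/asboolP.
have h1 : (#|E :\: E0| <= #|crossings E|)%N.
  have h e : e \in E :\: E0 -> exists f, (e, f) \in crossings E.
    rewrite !inE => /andP[+ eE]; rewrite eE /= => /forall_inPn[f fE /negPn cr].
    by exists f; rewrite inE /= eE fE.
  apply: leq_trans (leq_imset_card fst _).
  by apply/subset_leq_card/subsetP => e /h[f fP]; apply/imsetP; exists (e, f).
have := cardsID E0 E; have := subset_leq_card (subsetIr E E0); lia.
Qed.

Lemma cross_key e f : arc e -> arc f -> cross e f ->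
  key (crv e) != key (crv f).
Proof.
move=> /and4P[/andP[e1 _] /andP[e2 _] _ _] /and4P[/andP[f1 _] /andP[f2 _] _ _].
case=> x [y [[/andP[a1 a2] /andP[b1 b2] /andP[c1 c2] /andP[d1 d2]] /andP[h1 h2]]].
apply/eqP=> k.
have := val_par k (dom_conv e1 e2 a1 a2) (dom_conv e1 e2 b1 b2)
  (dom_conv f1 f2 c1 c2) (dom_conv f1 f2 d1 d2).
by move: h1 h2; rewrite /fe => *; lra.
Qed.

Lemma arc_disjoint e f : arc e -> arc f -> crv e = crv f -> e != f ->
  xr e <= xl f \/ xr f <= xl e.
Proof.
move=> /and4P[/andP[e1 e1'] /andP[e2 e2'] e3 /forallP e4].
move=> /and4P[/andP[f1 f1'] /andP[f2 f2'] f3 /forallP f4] ef nef.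
case: (leP (xr e) (xl f)) => [|l1]; first by left.
case: (leP (xr f) (xl e)) => [|l2]; first by right.
have /implyP g1 := e4 (lft f); have /implyP g2 := e4 (rgt f).
have /implyP g3 := f4 (lft e); have /implyP g4 := f4 (rgt e).
move: g1 g2 g3 g4; rewrite -/(xl e) -/(xl f) -/(xr e) -/(xr f) /fe.
rewrite -ef in f1' f2' *; rewrite f1' f2' e1' e2' l1 l2 !andbT /=.
case: (ltgtP (xl e) (xl f)) => [_ /(_ isT)//|_ _ _ /(_ isT)//|hl _ g2 _ g4].
case: (ltgtP (xr e) (xr f)) => [h|h|hr].
- by move: g4; rewrite h => /(_ isT).
- by move: g2; rewrite h => /(_ isT).
case/negP: nef; apply/eqP; rewrite (edgeE e) (edgeE f) ef; congr (_, _, _).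
  apply: pinj => //.
  by rewrite -(eqP e1') -(eqP f1') -/(xl e) -/(xl f) hl.
apply: pinj => //.
by rewrite -(eqP e2') -(eqP f2') -/(xr e) -/(xr f) hr.
Qed.

Lemma cross_inc e f : arc e -> arc f -> cross e f ->
  key (crv e) < key (crv f) -> exists x y, [/\ x < y,
  xl e <= x, y <= xr e, xl f <= x & y <= xr f] /\
  [/\ dom (crv e) x && dom (crv f) x, dom (crv e) y && dom (crv f) y &
   fe e x < fe f x] /\ fe f y < fe e y.
Proof.
move=> /and4P[/andP[e1 _] /andP[e2 _] _ _] /and4P[/andP[f1 _] /andP[f2 _] _ _].
case=> x [y [[/andP[a1 a2] /andP[b1 b2] /andP[c1 c2] /andP[d1 d2]] /andP[h1 h2]]] k.
have dxe := dom_conv e1 e2 a1 a2; have dye := dom_conv e1 e2 b1 b2.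
have dxf := dom_conv f1 f2 c1 c2; have dyf := dom_conv f1 f2 d1 d2.
exists x, y; rewrite dxe dye dxf dyf; split=> //; split=> //.
case: (ltgtP x y) => // h.
  have := val_mono k dye dxe dyf dxf h; rewrite -!/(fe _ _) => h'.
  by move: h1 h2 h'; lra.
by move: h1 h2; rewrite h; lra.
Qed.

(** The difference of the two curves is increasing, so their order switches once and in one
    direction. Distinct arcs of one curve do not overlap, so a second crossing pair would have to
    repeat the switch further along. *)
Lemma cross_uniq_key e f e' f' : arc e -> arc f -> arc e' -> arc f' ->
  cross e f -> cross e' f' -> crv e = crv e' -> crv f = crv f' ->
  key (crv e) < key (crv f) -> e = e' /\ f = f'.
Proof.
move=> ae af ae' af' c c' ee ff k.
have [x [y [[xy r1 r2 r3 r4] [[/andP[d1 d2] /andP[d3 d4] h1] h2]]]] := cross_inc ae af c k.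
have k' : key (crv e') < key (crv f') by rewrite -ee -ff.
have [x' [y' [[xy' r1' r2' r3' r4'] [[/andP[d1' d2'] /andP[d3' d4'] h1'] h2']]]] :=
  cross_inc ae' af' c' k'.
have far : y <= x' -> False.
  rewrite le_eqVlt => /orP[/eqP yx|lt].
    by move: h1' h2; rewrite -yx /fe ee ff; lra.
  have d1f := d1'; have d2f := d2'; rewrite -ee in d1f; rewrite -ff in d2f.
  have := val_mono k d3 d1f d4 d2f lt.
  by move: h1' h2; rewrite /fe -ee -ff; lra.
have far' : y' <= x -> False.
  rewrite le_eqVlt => /orP[/eqP yx|lt].
    by move: h1 h2'; rewrite -yx /fe ee ff; lra.
  have d1f := d3'; have d2f := d4'; rewrite -ee in d1f; rewrite -ff in d2f.
  have := val_mono k d1f d1 d2f d2 lt.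
  by move: h1 h2'; rewrite /fe -ee -ff; lra.
split; apply/eqP/negPn/negP => ne.
  have [h|h] := arc_disjoint ae ae' ee ne.
    by apply: far; apply: (le_trans r2); apply: (le_trans h).
  by apply: far'; apply: (le_trans r2'); apply: (le_trans h).
have [h|h] := arc_disjoint af af' ff ne.
  by apply: far; apply: (le_trans r4); apply: (le_trans h).
by apply: far'; apply: (le_trans r4'); apply: (le_trans h).
Qed.

Lemma card_crossings (E : {set edge}) : (forall e, e \in E -> arc e) ->
  (#|crossings E| <= #|C| ^ 2)%N.
Proof.
move=> Earc; rewrite -mulnn -card_prod.
rewrite -(card_in_imset (f := fun ef : edge * edge => (crv ef.1, crv ef.2))).
  exact: max_card.
move=> [e f] [e' f']; rewrite !inE /= => /and3P[eE fE /asboolP c].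
move=> /and3P[e'E f'E /asboolP c'] [ee ff].
have [ae af ae' af'] := And4 (Earc _ eE) (Earc _ fE) (Earc _ e'E) (Earc _ f'E).
have := cross_key ae af c; rewrite neq_lt => /orP[k|k].
  by have [-> ->] := cross_uniq_key ae af ae' af' c c' ee ff k.
by have [-> ->] := cross_uniq_key af ae af' ae' (crossC c) (crossC c') ff ee k.
Qed.

(* Two arcs through a common vertex differ by a monotone function vanishing
   there, which is an end of their common range. *)
Lemma cross_ends e f : arc e -> arc f -> cross e f ->
  [&& lft e != rgt e, lft e != lft f, lft e != rgt f, rgt e != lft f &
      rgt e != rgt f] && (lft f != rgt f).
Proof.
wlog k : e f / key (crv e) < key (crv f).
  move=> W ae af c; have := cross_key ae af c; rewrite neq_lt => /orP[k|k].
    exact: W.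
  have := W f e k af ae (crossC c).
  case/andP=> /and5P[h1 h2 h3 h4 h5] h6.
  by rewrite h6 h1 eq_sym h2 eq_sym h4 eq_sym h3 eq_sym h5.
move=> ae af c.
have [x [y [[xy r1 r2 r3 r4] [[/andP[d1 d2] /andP[d3 d4] h1] h2]]]] := cross_inc ae af c k.
case/and4P: ae => /andP[e1 /eqP e1'] /andP[e2 /eqP e2'] e3 _.
case/and4P: af => /andP[f1 /eqP f1'] /andP[f2 /eqP f2'] f3 _.
have ne u w : px u < px w -> u != w by move=> lt; apply: contraTneq lt => ->; rewrite ltxx.
rewrite (ne _ _ e3) (ne _ _ f3) andbT /=.
have xrl : xl e < xr f by apply: le_lt_trans r1 (lt_le_trans xy r4).
have xlr : xl f < xr e by apply: le_lt_trans r3 (lt_le_trans xy r2).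
rewrite (ne _ _ xrl) [rgt e == lft f]eq_sym (ne _ _ xlr) /=.
apply/andP; split; apply/eqP => ef.
  have xx : xl e = xl f by rewrite /xl ef.
  have : fe e (xl e) = fe f (xl f) by rewrite /fe e1' f1' ef.
  move: r1; rewrite le_eqVlt => /orP[/eqP r|r].
    by move: h1; rewrite -xx r; lra.
  have f1x : dom (crv f) (xl e) by rewrite xx.
  have := val_mono k e1 d1 f1x d2 r; rewrite -!/(fe _ _) -/(xl e) -xx.
  by move: h1; lra.
have xx : xr e = xr f by rewrite /xr ef.
have : fe e (xr e) = fe f (xr f) by rewrite /fe e2' f2' ef.
move: r2; rewrite le_eqVlt => /orP[/eqP r|r].
  by move: h2; rewrite -xx r; lra.
have f1x : dom (crv f) (xr e) by rewrite xx.
have := val_mono k d3 e2 d4 f1x r; rewrite -!/(fe _ _) -/(xr e) -xx.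
by move: h2; lra.
Qed.

(** Random sampling, with colourings by [k] colours in place of probabilities: a vertex survives
    when its colour is [ord0], a chance of 1/k. A vertex, an edge and a crossing depend on 1, 2 and
    4 distinct vertices, the last by [cross_ends]. Averaging [crossing_excess] and clearing the
    factor k^4 gives the bound. *)
Lemma crossing_lemma (E : {set edge}) (k : nat) : (0 < k)%N ->
  (forall e, e \in E -> arc e) ->
  (#|E| * k ^ 2 <= 3 * #|V| * k ^ 3 + #|C| ^ 2)%N.
Proof.
case: k => // k _ Earc; set K := k.+1.
pose col := {ffun V -> 'I_k.+1}.
pose mono (S : {set V}) (x : col) := [forall v in S, x v == ord0].
pose ends (e : edge) : {set V} := [set lft e; rgt e].
pose W x := [set v in [set: V] | mono [set v] x].
pose Ex x := [set e in E | mono (ends e) x].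
have monoP (S : {set V}) (x : col) : reflect (forall v, v \in S -> x v = ord0) (mono S x).
  apply: (iffP forall_inP) => [h v /h/eqP //|h v /h ->]; exact: eqxx.
have cS j (S : {set V}) : #|S| = j ->
    (#|[set x | mono S x]| * K ^ j = K ^ #|V|)%N.
  by move=> <-; exact: card_colorings.
have sumW : ((\sum_x #|W x|) * K = #|V| * K ^ #|V|)%N.
  rewrite sum_card_set big_distrl /= -sum_nat_const.
  apply: eq_big => [v|v _]; first by rewrite !inE.
  by rewrite -[K in LHS]expn1; apply: cS; rewrite cards1.
have sumE : ((\sum_x #|Ex x|) * K ^ 2 = #|E| * K ^ #|V|)%N.
  rewrite sum_card_set big_distrl /= -sum_nat_const.
  apply: eq_bigr => e /Earc/and4P[_ _ lt _]; apply: cS; rewrite cards2.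
  by case: eqVneq lt => // eq; rewrite /xl /xr eq ltxx.
have crE x : crossings (Ex x) =
    [set ef in crossings E | mono (ends ef.1 :|: ends ef.2) x].
  apply/setP => -[e f]; rewrite !inE /=.
  case: (e \in E); case: (f \in E); rewrite ?andbF //=.
  case: `[< cross e f >]; rewrite ?andbF ?andbT //=.
  apply/andP/monoP => [[/monoP h1 /monoP h2] v|h].
    by rewrite inE => /orP[/h1|/h2].
  by split; apply/monoP => v vE; apply: h; rewrite inE vE ?orbT.
have sumX : ((\sum_x #|crossings (Ex x)|) * K ^ 4 = #|crossings E| * K ^ #|V|)%N.
  under eq_bigr do rewrite crE.
  rewrite sum_card_set big_distrl /= -sum_nat_const.
  apply: eq_bigr => -[e f]; rewrite inE /= => /and3P[/Earc ae /Earc af /asboolP c].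
  have := cross_ends ae af c => /andP[/and5P[h1 h2 h3 h4 h5] h6].
  apply: cS; rewrite cardsU !cards2 h1 h6.
  have -> : ends e :&: ends f = set0.
    apply/setP => v; rewrite !inE; apply/negP=> /andP[/orP[/eqP->|/eqP->]].
      by rewrite (negbTE h2) (negbTE h3).
    by rewrite (negbTE h4) (negbTE h5).
  by rewrite cards0.
have step : (\sum_x #|Ex x| <= 3 * (\sum_x #|W x|) + \sum_x #|crossings (Ex x)|)%N.
  rewrite big_distrr -big_split /=; apply: leq_sum => x _.
  apply: crossing_excess => [e|e].
    by rewrite inE => /andP[/Earc].
  rewrite inE => /andP[_ /monoP h]; rewrite !inE /=.
  by apply/andP; split; apply/monoP => v; rewrite inE => /eqP ->; apply: h;
     rewrite !inE eqxx ?orbT.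
have K0 : (0 < K ^ #|V|)%N by rewrite expn_gt0.
have cX := card_crossings Earc.
rewrite -(leq_pmul2r K0).
have -> : (#|E| * K ^ 2 * K ^ #|V| = (\sum_x #|Ex x|) * K ^ 4)%N.
  by rewrite -mulnA (mulnC (K ^ 2)%N) mulnA -sumE -mulnA -expnD.
have -> : ((3 * #|V| * K ^ 3 + #|C| ^ 2) * K ^ #|V| =
    3 * (\sum_x #|W x|) * K ^ 4 + #|C| ^ 2 * K ^ #|V|)%N.
  rewrite mulnDl; congr (_ + _)%N.
  transitivity (3 * K ^ 3 * (#|V| * K ^ #|V|))%N.
    by move: (K ^ #|V|)%N => Z; ring.
  by rewrite -sumW (expnSr K 3); move: (\sum_x _)%N => Z; ring.
apply: (@leq_trans ((3 * (\sum_x #|W x|) + \sum_x #|crossings (Ex x)|) * K ^ 4)%N).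
  by rewrite leq_mul2r step orbT.
by rewrite mulnDl leq_add2l sumX leq_mul2r cX orbT.
Qed.

(** * The incidence bound for rich curves *)

Definition consec_edges :=
  [set e : edge | [&& on (crv e) (lft e), on (crv e) (rgt e), xl e < xr e &
    [forall v, ~~ [&& on (crv e) v, xl e < px v & px v < xr e]]]].

Lemma consec_arc e : e \in consec_edges -> arc e.
Proof.
rewrite inE => /and4P[h1 h2 h3 /forallP h4]; apply/and4P; split=> //.
apply/forallP => v; apply/implyP => /andP[a b].
have := h4 v; rewrite a b !andbT /on; case/andP: h1 => d1 _; case/andP: h2 => d2 _.
by rewrite (dom_conv d1 d2 (ltW a) (ltW b)).
Qed.

Lemma card_consec (k : nat) : (forall c, k < #|[set v | on c v]|)%N ->
  (#|C| * k <= #|consec_edges|)%N.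
Proof.
move=> hk; rewrite -sum_nat_const.
have -> : #|consec_edges| = (\sum_(c : C) #|[set e in consec_edges | crv e == c]|)%N.
  rewrite sum_card_set -sum1_card; apply: eq_bigr => e _.
  rewrite -[LHS](cards1 (crv e)); apply: eq_card => c.
  by rewrite !inE eq_sym.
apply: leq_sum => c _.
have /card_gt0P[v0 v0c] : (0 < #|[set v | on c v]|)%N by apply: leq_ltn_trans (hk c).
rewrite inE in v0c.
case: (arg_maxP (P := on c) px v0c) => m mc' mmax.
have mc : m \in [set v | on c v] by rewrite inE.
have : (k <= #|[set v | on c v] :\ m|)%N.
  by have := hk c; rewrite (cardsD1 m) mc.
move/leq_trans; apply.
apply: leq_trans (leq_imset_card lft _).
apply/subset_leq_card/subsetP => v; rewrite !inE => /andP[vm vc].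
have lt : px v < px m.
  rewrite lt_neqAle; apply/andP; split; last first.
    exact: mmax.
  apply: contraNneq vm => eq; apply/eqP/pinj => //.
  move: mc vc; rewrite inE => /andP[_ /eqP mc] /andP[_ /eqP vc].
  by rewrite -mc -vc eq.
have m0 : on c m && (px v < px m) by rewrite lt andbT; move: mc; rewrite inE.
case: (arg_minP (P := fun w => on c w && (px v < px w)) px m0) => w /andP[wc vw] wmin.
apply/imsetP; exists (c, v, w) => //; rewrite !inE eqxx andbT /crv /xl /xr /lft /rgt /=.
rewrite vc wc vw /=; apply/forallP => u; apply/negP => /and3P[uc vu uw].
by have := wmin u; rewrite uc vu leNgt uw => /(_ isT).
Qed.

(** The Szemeredi-Trotter bound. Joining consecutive points of every curve gives at least |C| (k-1)
    arcs, and [crossing_lemma] is applied to them at the best sampling rate. *)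
Lemma rich_curves (k : nat) : (1 < k)%N ->
  (forall c, k <= #|[set v | on c v]|)%N ->
  (#|C| * k ^ 3 <= 2304 * (#|V| ^ 2 + #|V| * k ^ 2))%N.
Proof.
move=> k1 hk.
have cE : (#|C| * k.-1 <= #|consec_edges|)%N.
  by apply: card_consec => c; rewrite prednK ?(ltn_trans _ k1).
have cl K : (0 < K)%N -> (#|consec_edges| * K ^ 2 <= 3 * #|V| * K ^ 3 + #|C| ^ 2)%N.
  by move=> K0; apply: crossing_lemma => // e; exact: consec_arc.
have e2 : (#|C| * k <= 2 * #|consec_edges|)%N by nia.
move: cl e2; set n := #|C|; set m := #|V|; set e := #|_| => cl e2.
have [m0|m0] := posnP m.
  have [n0|n0] := posnP n; first by rewrite n0.
  have [c _] : exists c : C, c \in C by apply/card_gt0P.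
  have := leq_trans (hk c) (max_card _).
  by rewrite -/m m0 leqNgt (ltn_trans _ k1).
have [small|big] := ltnP (n * k) (12 * m); first by nia.
(* This rate keeps 3 m K^3 below a quarter of n k K^2, which leaves n k K^2 <= 4 n^2. Combined with
   n k <= 24 m K it yields 2304 = 4 * 24^2. When n k < 12 m the rate would be 0, but the bound is
   then trivial. *)
pose K := (n * k %/ (12 * m))%N.
have K0 : (0 < K)%N by rewrite divn_gt0 ?muln_gt0.
have K1 : (12 * m * K <= n * k)%N by rewrite mulnC leq_divM.
have K2 : (n * k <= 24 * m * K)%N.
  have : (n * k < 12 * m * K.+1)%N by rewrite [ltnRHS]mulnC ltn_ceil ?muln_gt0.
  by nia.
have h1 : (n * k * K ^ 2 <= 4 * n ^ 2)%N.
  have := cl K K0.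
  have : (3 * m * K ^ 3 * 4 <= n * k * K ^ 2)%N.
    by have : (12 * m * K * K ^ 2 <= n * k * K ^ 2)%N; [rewrite leq_mul2r K1 orbT|lia].
  have : (n * k * K ^ 2 <= 2 * e * K ^ 2)%N by rewrite leq_mul2r e2 orbT.
  lia.
have n0 : (0 < n)%N by lia.
have h2 : (k * K ^ 2 <= 4 * n)%N.
  by rewrite -(leq_pmul2l n0); move: h1; rewrite expnS expn1 mulnA; lia.
have h3 : (n ^ 2 * k ^ 3 <= n * (2304 * m ^ 2))%N.
  have : ((n * k) ^ 2 <= (24 * m * K) ^ 2)%N by rewrite leq_sqr.
  have : ((24 * m) ^ 2 * (k * K ^ 2) <= (24 * m) ^ 2 * (4 * n))%N.
    by rewrite leq_mul2l h2 orbT.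
  rewrite !expnMn => a b.
  have : (n ^ 2 * k ^ 2 * k <= 24 ^ 2 * m ^ 2 * K ^ 2 * k)%N by rewrite leq_mul2r b orbT.
  by clear b; move: a; lia.
have : (n * k ^ 3 <= 2304 * m ^ 2)%N.
  by rewrite -(leq_pmul2l n0); apply: leq_trans h3; lia.
by move=> /leq_trans; apply; rewrite leq_mul2l leq_addr orbT.
Qed.

End Arrangement.

(** * Translates of a polynomial graph *)


(** Strict convexity as growth of the increments of a fixed step: this is literally the monotonicity
    of the difference of two translates, and it only mentions points of [I]. *)
Definition convex_on (R : realDomainType) (f : R -> R) (I : pred R) :=
  forall x y h, x < y -> 0 < h -> I x -> I y -> I (x + h) -> I (y + h) ->
  f (x + h) - f x < f (y + h) - f y.

Lemma poly_mvt2 (R : rcfType) (p : {poly R}) (x y h : R) : x < y -> 0 < h ->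
  exists2 z, x < z < y + h &
  (p.[y + h] - p.[y]) - (p.[x + h] - p.[x]) = p^`(2).[z] * h * (y - x).
Proof.
move=> xy h0; pose g := p \Po ('X + h%:P) - p.
have gE t : g.[t] = p.[t + h] - p.[t] by rewrite !hornerE horner_comp !hornerE.
have [c] := poly_mvt g xy; rewrite in_itv /= => /andP[xc cy].
rewrite !gE => ->.
have ch : c < c + h by rewrite ltrDl.
have [z] := poly_mvt p^`() ch; rewrite in_itv /= => /andP[cz zh] zE.
exists z; first by rewrite (lt_trans xc cz) (lt_trans zh) // ltrD2r.
congr (_ * _); have -> : g^`().[c] = p^`().[c + h] - p^`().[c].
  rewrite /g derivB deriv_comp derivD derivX derivC addr0 mulr1.
  by rewrite !hornerE horner_comp !hornerE.
by rewrite zE addrAC subrr add0r.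
Qed.

Lemma poly_pieces (R : rcfType) (p : {poly R}) (d : nat) :
  size p = d.+1 -> (1 < d)%N ->
  exists cls : R -> nat, [/\ forall x, (cls x < d)%N,
    forall x y, x <= y -> (cls x <= cls y)%N &
    forall i, convex_on (horner p) (fun x => cls x == i) \/
              convex_on (horner (- p)) (fun x => cls x == i)].
Proof.
move=> sp d1; pose q := p^`(2).
have pd : p`_d != 0.
  by have := lead_coef_eq0 p; rewrite -size_poly_eq0 lead_coefE sp /= => ->.
have q0 : q != 0.
  apply: contraNneq pd => q0; have := coef_derivn 2 p (d - 2).
  rewrite -/q q0 coef0 subnKC // => /esym/eqP.
  by rewrite mulrn_eq0 eqn0Ngt ffact_gt0 d1.
have sq : (size q <= d.-1)%N.
  apply/leq_sizeP => j dj; rewrite coef_derivn nth_default ?mul0rn // sp.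
  by move: dj d1; lia.
have uR : uniq (rootsR q) by exact: uniq_roots.
have rR x : (x \in rootsR q) = root q x.
  by have := roots_on_rootsR q0 x; rewrite in_itv.
(* The class of [x] is the number of roots of the second derivative strictly below [x]. Classes are
   intervals, a root belonging to the class on its left, so no root lies strictly between two points
   of one class. *)
pose cls x := count (fun z => z < x) (rootsR q).
have clsD x y : x < y -> cls y = (cls x + count (fun z => (x <= z)%R && (z < y)%R) (rootsR q))%N.
  move=> xy; rewrite /cls -count_predUI -[LHS]addn0; congr (_ + _)%N; last first.
    apply/eqP; rewrite eq_sym -leqn0 leqNgt -has_count; apply/hasPn => z _ /=.
    by rewrite ltNge; case: (x <= z).
  apply: eq_count => z /=.
  by case: (ltP z x) => //= zx; rewrite (lt_trans zx xy).
have no_root x z y : cls x = cls y -> x < z -> z < y -> ~~ root q z.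
  move=> cxy xz zy; apply/negP => rz.
  have := clsD _ _ (lt_trans xz zy); rewrite cxy => /eqP.
  rewrite -{1}[cls y]addn0 eqn_add2l eq_sym -leqn0 leqNgt -has_count => /hasPn/(_ z).
  by rewrite rR rz (ltW xz) zy => /(_ isT).
exists cls; split.
- move=> x; apply: leq_ltn_trans (count_size _ _) _.
  have rall : all (root q) (rootsR q) by apply/allP => z; rewrite rR.
  by apply: leq_trans (max_poly_roots q0 rall uR) _; apply: leq_trans sq (leq_pred _).
- move=> x y; rewrite le_eqVlt => /orP[/eqP->//|xy].
  by rewrite (clsD _ _ xy) leq_addr.
move=> i.
(* Inside a class [q] takes only one strict sign: a root between [z] and [z'] would lie between two
   points of the class, possibly one from each of the two triples. *)
have sgn x z y x' z' y' : cls x = i -> cls y = i -> cls x' = i -> cls y' = i ->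
    x < z -> z < y -> x' < z' -> z' < y' -> q.[z] < 0 -> 0 < q.[z'] -> False.
  move=> hx hy hx' hy' xz zy xz' zy' n1 n2.
  have [w wr] : exists2 w, root q w & (x < w < y) || (x' < w < y') ||
     (x < w < y') || (x' < w < y).
    have [zz|zz] := leP z z'.
      have h : q.[z] * q.[z'] < 0 by rewrite nmulr_rlt0.
      have [w] := poly_ivtoo zz h.
      rewrite in_itv /= => /andP[a b] r; exists w => //.
      by rewrite (lt_trans xz a) (lt_trans b zy') !orbT.
    have h : q.[z'] * q.[z] < 0 by rewrite pmulr_rlt0.
    have [w] := poly_ivtoo (ltW zz) h.
    rewrite in_itv /= => /andP[a b] r; exists w => //.
    by rewrite (lt_trans xz' a) (lt_trans b zy) !orbT.
  by case/orP => [/orP[/orP[]|]|] /andP[a b]; move: wr; apply/negP;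
     apply: no_root a b; congruence.
case: (pselect (exists x z y, [/\ cls x = i, cls y = i, x < z, z < y & q.[z] < 0])).
  case=> x' [z' [y' [hx' hy' xz' zy' n1]]]; right.
  move=> x y h xy h0 /eqP cx /eqP cy /eqP cxh /eqP cyh.
  have [z /andP[xz zy]] := poly_mvt2 p xy h0; rewrite -/q => e.
  have qz : q.[z] < 0.
    have := no_root x z (y + h) ltac:(congruence) xz zy.
    rewrite rootE; case: (ltgtP q.[z] 0) => // q1 _.
    by case: (sgn _ _ _ _ _ _ hx' hy' cx cyh xz' zy' xz zy n1 q1).
  have : q.[z] * h * (y - x) < 0 by rewrite -mulrA nmulr_rlt0 // mulr_gt0 ?subr_gt0.
  by rewrite -e !hornerN; lra.
move=> npos; left.
move=> x y h xy h0 /eqP cx /eqP cy /eqP cxh /eqP cyh.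
have [z /andP[xz zy]] := poly_mvt2 p xy h0; rewrite -/q => e.
have qz : 0 < q.[z].
  have := no_root x z (y + h) ltac:(congruence) xz zy.
  rewrite rootE; case: (ltgtP q.[z] 0) => // q1 _.
  by case: npos; exists x, z, (y + h).
have : 0 < q.[z] * h * (y - x) by rewrite -mulrA !mulr_gt0 ?subr_gt0.
by rewrite -e; lra.
Qed.

Definition pt (R : realType) (psi : {poly R}) (x : R) : R * R := (x, psi.[x]).

Lemma card_seq_sub_set (T : choiceType) (U : seq T) (P : pred T) : uniq U ->
  #|[set v : seq_sub U | P (ssval v)]| = count P U.
Proof.
move=> uU; rewrite cardE -(size_map (@ssval _ _)) -size_filter; apply/perm_size/uniq_perm.
- by rewrite map_inj_uniq ?enum_uniq //; exact: val_inj.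
- exact: filter_uniq.
move=> u; rewrite mem_filter; apply/mapP/andP => [[v + ->]|[Pu uU']].
  by rewrite mem_enum inE => ->; split=> //; exact: ssvalP.
by exists (SeqSub uU'); rewrite // mem_enum inE.
Qed.

(** The curves are the translates of the arc over [I], indexed by their vectors. The key is the
    horizontal shift, its sign reversed by [sg] on a concave arc; equal shifts give vertical
    translates. *)
Lemma rich_piece (R : realType) (psi : {poly R}) (I : pred R)
    (A : seq R) (U D : seq (R * R)) (k : nat) :
  (forall x y z, I x -> I z -> x <= y -> y <= z -> I y) ->
  convex_on (horner psi) I \/ convex_on (horner (- psi)) I ->
  uniq A -> uniq U -> uniq D -> (1 < k)%N ->
  (forall n, n \in D -> (k <= count (fun x => I x && ((n + pt psi x)%R \in U)) A)%N) ->
  (size D * k ^ 3 <= 2304 * (size U ^ 2 + size U * k ^ 2))%N.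
Proof.
move=> Iconv cvx uA uU uD k1 hk.
have [sg [sg2 cv]] : exists sg : R, sg * sg = 1 /\ convex_on (fun x => sg * psi.[x]) I.
  case: cvx => h; [exists 1 | exists (-1)]; split; rewrite ?mulrNN ?mulr1 //.
    by move=> x y t *; rewrite !mul1r; exact: (h x y t).
  by move=> x y t *; have := h x y t; rewrite !hornerN !mulN1r; apply.
pose V := seq_sub U; pose C := seq_sub D.
pose px (v : V) := (ssval v).1; pose py (v : V) := (ssval v).2.
pose dom (c : C) x := I (x - (ssval c).1).
pose val (c : C) x := psi.[x - (ssval c).1] + (ssval c).2.
pose key (c : C) := sg * (ssval c).1.
have := @rich_curves R V C px py _ dom val key _ _ _ _ k k1.
rewrite !card_seq_sub //; apply.
- by move=> [[u1 u2] hu] [[v1 v2] hv]; rewrite /px /py /= => e1 e2; apply: val_inj; rewrite /= e1 e2.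
- move=> c x y z; rewrite /dom => hx hz xy yz.
  by apply: Iconv hx hz _ _; rewrite lerD2r.
- move=> [[a b] hc] [[a' b'] hc'] x y; rewrite /key /dom /val /= => kk dx dy dx' dy' xy.
  have := sg2; rewrite -expr2 => /eqP; rewrite sqrf_eq1 => /orP[]/eqP sE.
    have := cv (x - a') (y - a') (a' - a); rewrite sE !mul1r in kk *.
    rewrite !subrKA => /(_ _ _ dx' dy' dx dy).
    by rewrite ltrD2r subr_gt0 => /(_ xy kk); lra.
  have := cv (x - a) (y - a) (a - a'); rewrite sE !mulN1r in kk *.
  rewrite !subrKA => /(_ _ _ dx dy dx' dy').
  by rewrite ltrD2r subr_gt0 -ltrN2 => /(_ xy kk); lra.
- move=> [[a b] hc] [[a' b'] hc'] x y; rewrite /key /dom /val /= => kk _ _ _ _.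
  have -> : a = a' by rewrite -[a]mul1r -sg2 -mulrA kk mulrA sg2 mul1r.
  by lra.
- move=> [[a b] hc] [[a' b'] hc'] x; rewrite /key /dom /val /= => kk _ _.
  have aa : a = a' by rewrite -[a]mul1r -sg2 -mulrA kk mulrA sg2 mul1r.
  by rewrite {1}aa => /addrI bb; apply: val_inj; rewrite /= aa bb.
move=> [n nD]; apply: leq_trans (hk n nD) _.
rewrite -size_filter; set F := filter _ _.
have uF : uniq F by rewrite filter_uniq.
have FU x : x \in F -> n + pt psi x \in U by rewrite mem_filter => /andP[/andP[]].
have -> : #|[set v | on px py dom val (SeqSub nD) v]| =
    count (fun u => I (u.1 - n.1) && (psi.[u.1 - n.1] + n.2 == u.2)) U.
  by rewrite -card_seq_sub_set.
rewrite -size_filter -(size_map (fun x => n + pt psi x)); apply: uniq_leq_size.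
  by rewrite map_inj_uniq // => x y [/addrI].
move=> u /mapP[x xF ->]; rewrite mem_filter FU // andbT /=.
rewrite addrC addKr addrC eqxx andbT.
by move: xF; rewrite mem_filter => /andP[/andP[]].
Qed.



Definition incidences (R : realType) (psi : {poly R}) (A : seq R) (U : seq (R * R))
  (n : R * R) := count (fun x => (n + pt psi x)%R \in U) A.

(** Pigeonhole over [d] classes: one of them carries at least k' incidences, k' being k/d rounded
    up. Replacing k by k' costs d^3 and summing over the classes another d; [d < k] ensures 1 < k',
    as [rich_piece] demands. *)
Lemma rich_translates (R : realType) (psi : {poly R}) (d : nat)
    (A : seq R) (U D : seq (R * R)) (k : nat) :
  size psi = d.+1 -> (1 < d)%N -> uniq A -> uniq U -> uniq D -> (d < k)%N ->
  (size [seq n <- D | k <= incidences psi A U n] * k ^ 3 <=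
     2304 * d ^ 4 * (size U ^ 2 + size U * k ^ 2))%N.
Proof.
move=> sp d1 uA uU uD dk.
have [cls [cls_lt cls_mono cvx]] := poly_pieces sp d1.
pose inci i n := count (fun x => (cls x == i) && ((n + pt psi x)%R \in U)) A.
have incE n : incidences psi A U n = (\sum_(i < d) inci i n)%N.
  rewrite /incidences -sum1_count big_mkcond /=.
  under [RHS]eq_bigr do rewrite /inci -sum1_count big_mkcond /=.
  rewrite exchange_big /=; apply: eq_bigr => x _.
  rewrite (bigD1 (Ordinal (cls_lt x))) //= eqxx /= big1 ?addn0 // => i.
  by rewrite eq_sym -val_eqE /= => /negbTE ->.
pose k' := (k.-1 %/ d).+1.
have kk' : (k <= d * k')%N.
  have := ltn_ceil k.-1 (ltnW d1); rewrite -/k' mulnC; lia.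
have k'1 : (1 < k')%N by rewrite ltnS divn_gt0 ?(ltnW d1) //; lia.
have k'k : (k' <= k)%N.
  by rewrite /k'; have := leq_div k.-1 d; lia.
pose Di i := [seq n <- D | (k' <= inci i n)%N].
have bi (i : 'I_d) : (size (Di i) * k' ^ 3 <= 2304 * (size U ^ 2 + size U * k' ^ 2))%N.
  apply: (@rich_piece _ psi (fun x => cls x == i) A U) => //.
  - move=> x y z /eqP cx /eqP cz xy yz; apply/eqP/anti_leq.
    by rewrite -{1}cz -cx !cls_mono.
  - exact: filter_uniq.
  - by move=> n; rewrite mem_filter => /andP[].
have le_sum : (size [seq n <- D | k <= incidences psi A U n] <= \sum_(i < d) size (Di i))%N.
  rewrite size_filter -sum1_count big_mkcond /=.
  under [leqRHS]eq_bigr do rewrite size_filter -sum1_count big_mkcond /=.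
  rewrite exchange_big /=; apply: leq_sum => n _; case: ifP => // kn.
  have [i hi] : exists i : 'I_d, (k' <= inci i n)%N.
    apply/existsP; apply: contraLR kn => /existsPn h; rewrite -ltnNge incE.
    have : (\sum_(i < d) inci i n <= d * k'.-1)%N.
      rewrite -[X in (_ <= X * _)%N]card_ord -sum_nat_const.
      by apply: leq_sum => i _; have := h i; rewrite -ltnNge.
    move=> /leq_ltn_trans; apply; rewrite /k' /= mulnC.
    by apply: leq_ltn_trans (leq_divM _ _) _; lia.
  by rewrite (bigD1 i) //= hi.
apply: leq_trans (leq_mul le_sum (leqnn _)) _.
rewrite big_distrl /=.
apply: (@leq_trans (\sum_(i < d) 2304 * d ^ 3 * (size U ^ 2 + size U * k ^ 2)))%N.
  apply: leq_sum => i _.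
  apply: (@leq_trans (size (Di i) * (d * k') ^ 3)%N).
    by rewrite leq_mul2l leq_exp2r ?kk' ?orbT.
  rewrite expnMn mulnCA mulnC -[leqRHS]mulnA [(d ^ 3 * _)%N]mulnC mulnA leq_mul2r.
  apply/orP; right; apply: leq_trans (bi i) _.
  by rewrite leq_mul2l /= leq_add2l leq_mul2l leq_exp2r // k'k orbT.
rewrite sum_nat_const card_ord; apply: eq_leq.
by move: (size U ^ 2 + _)%N => z; ring.
Qed.

(** * Moments of incidence counts *)

Lemma layer_cake (R : comRingType) (T : eqType) (D : seq T) (I : T -> nat)
    (phi : nat -> R) (K M : nat) :
  (forall n, n \in D -> (I n <= M)%N) ->
  \sum_(n <- D | (K <= I n)%N) phi (I n) =
  phi K * (count (fun n => K <= I n)%N D)%:R +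
  \sum_(K <= i < M) (phi i.+1 - phi i) * (count (fun n => i < I n)%N D)%:R.
Proof.
move=> IM.
have cE (P : pred T) : (count P D)%:R = \sum_(n <- D) (P n)%:R :> R.
  by rewrite -sum1_count natr_sum big_mkcond; apply: eq_bigr => n _; case: (P n).
under [X in _ + X]eq_bigr do rewrite cE mulr_sumr.
rewrite exchange_big cE mulr_sumr -big_split /= big_mkcond /=.
apply: eq_big_seq => n nD; case: leqP => h; last first.
  rewrite mulr0 add0r big_nat big1 // => i /andP[Ki _].
  by rewrite ltnNge (leq_trans (ltnW h) Ki) mulr0.
rewrite mulr1 (big_cat_nat h (IM _ nD)) /=.
have -> : \sum_(I n <= i < M) (phi i.+1 - phi i) * (i < I n)%N%:R = 0.
  rewrite big_nat big1 // => i /andP[Ii _].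
  by rewrite ltnNge Ii mulr0.
rewrite addr0 big_nat (eq_bigr (fun i => phi i.+1 - phi i)).
  by rewrite -big_nat telescope_sumr // addrC subrK.
by move=> i /andP[_ ->]; rewrite mulr1.
Qed.

Lemma cauchy_schwarz (R : realDomainType) (I : Type) (r : seq I) (P : pred I) (f g : I -> R) :
  (\sum_(i <- r | P i) f i * g i) ^+ 2 <=
  (\sum_(i <- r | P i) f i ^+ 2) * (\sum_(i <- r | P i) g i ^+ 2).
Proof.
have : 0 <= \sum_(i <- r | P i) \sum_(j <- r | P j) (f i * g j - f j * g i) ^+ 2.
  by apply: sumr_ge0 => i _; apply: sumr_ge0 => j _; exact: sqr_ge0.
have -> : \sum_(i <- r | P i) \sum_(j <- r | P j) (f i * g j - f j * g i) ^+ 2 =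
  \sum_(i <- r | P i) \sum_(j <- r | P j) (f i ^+ 2 * g j ^+ 2) +
  \sum_(i <- r | P i) \sum_(j <- r | P j) (g i ^+ 2 * f j ^+ 2) -
  (\sum_(i <- r | P i) \sum_(j <- r | P j) (f i * g i) * (f j * g j)) *+ 2.
  rewrite -sumrMnl -big_split -sumrB /=; apply: eq_bigr => i _.
  rewrite -sumrMnl -big_split -sumrB /=; apply: eq_bigr => j _.
  by ring.
by rewrite -!big_distrlr /=; set a := \sum_(i <- r | P i) f i * g i; lra.
Qed.

Lemma sum_inv_sqr (R : realFieldType) (K M : nat) : (0 < K)%N ->
  \sum_(K <= i < M) (i.+1%:R ^+ 2)^-1 <= K%:R^-1 :> R.
Proof.
move=> K0; have [MK|KM] := leqP M K.
  by rewrite big_geq // invr_ge0.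
apply: (@le_trans _ _ (\sum_(K <= i < M) (- (i.+1%:R)^-1 - - (i%:R)^-1))).
  apply: ler_sum_nat => i /andP[Ki _].
  have i0 : 0 < i%:R :> R by rewrite ltr0n (leq_trans K0 Ki).
  have i1 : 0 < i.+1%:R :> R by rewrite ltr0n.
  have iE : i.+1%:R = i%:R + 1 :> R by rewrite -natr1.
  rewrite -subr_ge0.
  have -> : - i.+1%:R^-1 - - i%:R^-1 - (i.+1%:R ^+ 2)^-1 =
    (i%:R * i.+1%:R ^+ 2)^-1 :> R.
    by rewrite iE; field; rewrite -iE !lt0r_neq0.
  by rewrite invr_ge0 mulr_ge0 ?ltW // exprn_gt0.
rewrite (telescope_sumr (fun i => - (i%:R)^-1 : R)) ?(ltnW KM) //.
by rewrite opprK gerDr oppr_le0 invr_ge0.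
Qed.



Lemma sum_count_mem (T : eqType) (U s : seq T) : uniq U ->
  (\sum_(u <- U) count_mem u s = count (mem U) s)%N.
Proof.
move=> uU; under eq_bigr do rewrite -sum1_count big_mkcond /=.
rewrite exchange_big -sum1_count [RHS]big_mkcond /=; apply: eq_bigr => x _.
rewrite -big_mkcond sum1_count (eq_count (a2 := pred1 x)) ?count_uniq_mem //=.
Qed.

(** A point of [U] and an abscissa in [A] determine the translation vector. *)
Lemma sum_inc_le (R : realType) (psi : {poly R}) (A : seq R)
    (U D : seq (R * R)) : uniq D ->
  (\sum_(n <- D) incidences psi A U n <= size U * size A)%N.
Proof.
move=> uD; under eq_bigr do rewrite /incidences -sum1_count big_mkcond /=.
rewrite exchange_big /= mulnC.
apply: (@leq_trans (\sum_(x <- A) size U)%N); last first.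
  by rewrite big_const_seq count_predT iter_addn_0 mulnC.
apply: leq_sum => x _; rewrite -big_mkcond sum1_count -size_filter.
rewrite -(size_map (fun n => n + pt psi x)); apply: uniq_leq_size.
  by rewrite map_inj_uniq ?filter_uniq //; exact: addIr.
by move=> u /mapP[n + ->]; rewrite mem_filter => /andP[].
Qed.

(** Of the factor 4 in [sum_sq_rich], one unit pays for the translates with at most [d] incidences,
    one for the boundary term of the layer-cake sum and two for the increments of i^2. *)
Definition stC (d : nat) : nat := 4 * (2304 * d ^ 4).

Lemma sum_sq_rich (R : realType) (psi : {poly R}) (d : nat)
    (A : seq R) (U D : seq (R * R)) (m : nat) :
  size psi = d.+1 -> (1 < d)%N -> uniq A -> uniq U -> uniq D -> (0 < m)%N ->
  \sum_(n <- D | (m <= incidences psi A U n)%N) (incidences psi A U n)%:R ^+ 2 <=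
  (stC d)%:R * ((size U)%:R ^+ 2 / m%:R + (size U)%:R * (size A)%:R) :> R.
Proof.
move=> sp d1 uA uU uD m0; set I := incidences psi A U; set V : R := (size U)%:R.
(* [rich_translates] only applies above [d]; translates with at most [d] incidences are absorbed by
   the first moment. *)
set N : R := (size A)%:R; pose K := maxn m d.+1.
have K0 : (0 < K)%N by rewrite leq_max m0.
have V0 : 0 <= V by exact: ler0n.
have N0 : 0 <= N by exact: ler0n.
have small : \sum_(n <- D | (m <= I n)%N) (I n)%:R ^+ 2 <=
    \sum_(n <- D | (K <= I n)%N) (I n)%:R ^+ 2 + d%:R * (V * N) :> R.
  apply: (@le_trans _ _ (\sum_(n <- D | (K <= I n)%N) (I n)%:R ^+ 2 +
      d%:R * \sum_(n <- D) (I n)%:R)).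
    rewrite mulr_sumr big_mkcond [X in _ <= X + _]big_mkcond -big_split /=.
    apply: ler_sum => n _; rewrite geq_max; case: (leqP m (I n)) => mI /=; last first.
      by rewrite add0r mulr_ge0.
    case: ltnP => dI /=; first by rewrite lerDl mulr_ge0.
    by rewrite add0r expr2 ler_wpM2r // ler_nat.
  rewrite lerD2l ler_wpM2l // -natr_sum -natrM ler_nat.
  exact: sum_inc_le.
pose cnt k := size [seq n <- D | (k <= I n)%N].
pose C0 : R := (2304 * d ^ 4)%:R.
have C00 : 0 <= C0 by exact: ler0n.
have dC0 : d%:R <= C0.
  rewrite ler_nat; apply: (@leq_trans (d ^ 4)%N); last by rewrite leq_pmull.
  by rewrite -{1}(expn1 d) leq_pexp2l // ltnW.
have rich k : (K <= k)%N -> (cnt k)%:R <= C0 * (V ^+ 2 / k%:R ^+ 3 + V / k%:R).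
  move=> Kk; have k0 : 0 < k%:R :> R by rewrite ltr0n (leq_trans K0).
  have dk : (d < k)%N by apply: leq_trans Kk; rewrite leq_max leqnn orbT.
  have := rich_translates sp d1 uA uU uD dk; rewrite -/(cnt k).
  rewrite -(ler_nat R) natrM natrX [X in _ <= X -> _]natrM -/C0 natrD natrX natrM natrX -/V => h.
  rewrite -(ler_pM2r (exprn_gt0 3 k0)) (le_trans h) //.
  rewrite le_eqVlt; apply/orP; left; apply/eqP.
  by field; rewrite lt0r_neq0.
have IA n : n \in D -> (I n <= size A)%N by move=> _; exact: count_size.
have cntE k : cnt k = count (fun n => k <= I n)%N D by rewrite /cnt size_filter.
have big : \sum_(n <- D | (K <= I n)%N) (I n)%:R ^+ 2 <=
    3 * C0 * (V ^+ 2 / K%:R + V * N).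
  have [AK|KA] := ltnP (size A) K.
    rewrite big_seq_cond big_pred0 ?mulr_ge0 ?addr_ge0 ?mulr_ge0 ?invr_ge0 ?sqr_ge0 //.
    by move=> n; apply/negP=> /andP[/IA a b]; move: (leq_trans b a); rewrite leqNgt AK.
  rewrite (layer_cake (fun i => i%:R ^+ 2) K IA) -cntE.
  under eq_bigr do rewrite -cntE.
  have Kp : 0 < K%:R :> R by rewrite ltr0n.
  have KN : K%:R <= N by rewrite ler_nat.
  have t1 : K%:R ^+ 2 * (cnt K)%:R <= C0 * (V ^+ 2 / K%:R + V * N).
    apply: (@le_trans _ _ (K%:R ^+ 2 * (C0 * (V ^+ 2 / K%:R ^+ 3 + V / K%:R)))).
      by rewrite ler_wpM2l ?sqr_ge0 // rich.
    have -> : K%:R ^+ 2 * (C0 * (V ^+ 2 / K%:R ^+ 3 + V / K%:R)) =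
      C0 * (V ^+ 2 / K%:R + V * K%:R) by field; rewrite lt0r_neq0.
    by rewrite ler_wpM2l // lerD2l ler_wpM2l.
  have t2 : \sum_(K <= i < size A) (i.+1%:R ^+ 2 - i%:R ^+ 2) * (cnt i.+1)%:R <=
     2 * C0 * (V ^+ 2 * \sum_(K <= i < size A) (i.+1%:R ^+ 2)^-1 + V * N).
    apply: (@le_trans _ _ (\sum_(K <= i < size A)
        2 * C0 * (V ^+ 2 * (i.+1%:R ^+ 2)^-1 + V))).
      apply: ler_sum_nat => i /andP[Ki _].
      have i1 : 0 < i.+1%:R :> R by rewrite ltr0n.
      have iE : i.+1%:R = i%:R + 1 :> R by rewrite -natr1.
      apply: (@le_trans _ _ (2 * i.+1%:R * (cnt i.+1)%:R)).
        by rewrite ler_wpM2r // iE; have := ler0n R i; nra.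
      apply: (@le_trans _ _ (2 * i.+1%:R * (C0 * (V ^+ 2 / i.+1%:R ^+ 3 + V / i.+1%:R)))).
        by rewrite ler_wpM2l ?mulr_ge0 // rich // (leq_trans Ki).
      by rewrite le_eqVlt; apply/orP; left; apply/eqP; field;
         rewrite addrC -iE lt0r_neq0.
    rewrite -mulr_sumr ler_wpM2l ?mulr_ge0 // big_split /= -mulr_sumr lerD2l.
    rewrite sumr_const_nat -mulr_natr ler_wpM2l // ler_nat leq_subr //.
  have t3 : V ^+ 2 * \sum_(K <= i < size A) (i.+1%:R ^+ 2)^-1 <= V ^+ 2 / K%:R.
    by rewrite ler_wpM2l ?sqr_ge0 // sum_inv_sqr.
  have t4 := ler_wpM2l (mulr_ge0 (ler0n R 2) C00) t3.
  by move: t1 t2 t4; rewrite !mulrDr; lra.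
have VK : V ^+ 2 / K%:R <= V ^+ 2 / m%:R.
  by rewrite ler_wpM2l ?sqr_ge0 // lef_pV2 ?posrE ?ltr0n // ler_nat leq_max leqnn.
have -> : (stC d)%:R = 4 * C0 :> R by rewrite /stC natrM.
have h1 := ler_wpM2l C00 VK.
have h2 : d%:R * (V * N) <= C0 * (V * N) by rewrite ler_wpM2r ?mulr_ge0.
have h3 : 0 <= C0 * (V ^+ 2 / m%:R).
  by rewrite mulr_ge0 // mulr_ge0 ?sqr_ge0 // invr_ge0.
by move: small big h1 h2 h3; rewrite !mulrDr; lra.
Qed.

(** * Multisets and their energy *)



Definition madd (G : zmodType) (L1 L2 : seq G) := [seq x + y | x <- L1, y <- L2].

Definition coinc (T : eqType) (L1 L2 : seq T) :=
  (\sum_(x <- L1) count_mem x L2)%N.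

Definition en (T : eqType) (L : seq T) := coinc L L.

Definition pts (R : realType) (psi : {poly R}) (A : seq R) := map (pt psi) A.

Lemma sum_count_uniq (R : pzSemiRingType) (T : eqType) (D s : seq T)
    (f : T -> R) : uniq D -> {subset s <= D} ->
  \sum_(x <- s) f x = \sum_(x <- D) (count_mem x s)%:R * f x.
Proof.
move=> uD sD.
have E x : x \in s -> f x = \sum_(y <- D) (x == y)%:R * f y.
  move=> /sD xs; rewrite (bigD1_seq x) //= eqxx mul1r.
  by rewrite big1 ?addr0 // => y /negbTE; rewrite eq_sym => ->; rewrite mul0r.
rewrite (eq_big_seq _ E) exchange_big /=; apply: eq_bigr => y _.
rewrite -mulr_suml -sum1_count natr_sum [in RHS]big_mkcond /=; congr (_ * _).
by apply: eq_bigr => x _; case: eqP.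
Qed.

Lemma sum_undupR (R : pzSemiRingType) (T : eqType) (s : seq T) (f : T -> R) :
  \sum_(x <- s) f x = \sum_(x <- undup s) (count_mem x s)%:R * f x.
Proof.
apply: sum_count_uniq; first exact: undup_uniq.
by move=> x; rewrite mem_undup.
Qed.

Lemma enE (R : pzSemiRingType) (T : eqType) (L : seq T) :
  (en L)%:R = \sum_(x <- undup L) (count_mem x L)%:R ^+ 2 :> R.
Proof.
by rewrite /en /coinc natr_sum [LHS]sum_undupR; apply: eq_bigr => x _; rewrite expr2.
Qed.

Lemma count_madd (G : zmodType) (P : pred G) (L1 L2 : seq G) :
  count P (madd L1 L2) = (\sum_(x <- L1) count (fun y => P (x + y)%R) L2)%N.
Proof.
rewrite /madd; elim: L1 => [|x L1 IH]; first by rewrite big_nil.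
by rewrite big_cons /= count_cat count_map IH.
Qed.

Lemma size_madd (G : zmodType) (L1 L2 : seq G) :
  size (madd L1 L2) = (size L1 * size L2)%N.
Proof. by rewrite size_allpairs. Qed.

Definition wC (R : realType) (d : nat) : R := 64 * (stC d)%:R.

(* The incidence bound with the translate by [n] weighted by its multiplicity
   in [L]: translates poor in points of [U] are counted trivially, the others
   by Cauchy-Schwarz; the threshold [k0] balances the two. *)
Lemma level_set (R : realType) (psi : {poly R}) (d : nat)
    (A : seq R) (L U : seq (R * R)) (t : R) :
  size psi = d.+1 -> (1 < d)%N -> uniq A -> uniq U -> 0 < t ->
  (forall u, u \in U -> t <= (count_mem u (madd L (pts psi A)))%:R) ->
  (size U)%:R * t ^+ 3 <=
    wC R d * (en L)%:R * ((size L)%:R + (size A)%:R * t).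
Proof.
move=> sp d1 uA uU t0 Ut; set I := incidences psi A U; set V : R := (size U)%:R.
set N : R := (size A)%:R; set W1 : R := (size L)%:R; set W2 : R := (en L)%:R.
have V0 : 0 <= V by exact: ler0n.
have N0 : 0 <= N by exact: ler0n.
have W10 : 0 <= W1 by exact: ler0n.
have W20 : 0 <= W2 by exact: ler0n.
pose C : R := (stC d)%:R; have C0 : 0 <= C by exact: ler0n.
pose w n : R := (count_mem n L)%:R.
have mass : t * V <= \sum_(n <- undup L) w n * (I n)%:R.
  rewrite -sum_undupR -natr_sum.
  have -> : (\sum_(n <- L) I n = \sum_(u <- U) count_mem u (madd L (pts psi A)))%N.
    rewrite sum_count_mem // count_madd; apply: eq_bigr => n _.
    by rewrite /I /incidences /pts count_map.
  rewrite /V -sum1_size !natr_sum mulr_sumr big_seq [leRHS]big_seq.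
  by apply: ler_sum => u uU'; rewrite mulr1 Ut.
(* The 16 makes C W2 V^2 / m at most (t V)^2 / 16. Either the poor translates carry half of the mass
   t V, or X does, and then this term is absorbed by (t V)^2. *)
pose k0 : R := 16 * C * W2 / t ^+ 2.
have t2 : 0 < t ^+ 2 by rewrite exprn_gt0.
have k0E : k0 * t ^+ 2 = 16 * C * W2 by rewrite /k0 divfK // gt_eqF.
have k00 : 0 <= k0 by rewrite mulr_ge0 ?invr_ge0 ?(ltW t2) ?mulr_ge0.
pose m := (Num.trunc k0).+1.
have [m1 m2] : (Num.trunc k0)%:R <= k0 /\ k0 < m%:R.
  by have /andP[] := truncn_itv k00.
pose X := \sum_(n <- undup L | (m <= I n)%N) w n * (I n)%:R.
have split_mass : \sum_(n <- undup L) w n * (I n)%:R <= k0 * W1 + X.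
  have -> : W1 = \sum_(n <- undup L) w n.
    by rewrite /W1 -sum1_size natr_sum sum_undupR; apply: eq_bigr => n _; rewrite mulr1.
  rewrite mulr_sumr /X [X in _ <= _ + X]big_mkcond -big_split /=; apply: ler_sum => n _.
  case: (leqP m (I n)) => mI; first by rewrite lerDr mulr_ge0 // ler0n.
  rewrite addr0 mulrC ler_wpM2r ?ler0n // (le_trans _ m1) // ler_nat.
  by rewrite -ltnS.
pose S := \sum_(n <- undup L | (m <= I n)%N) (I n)%:R ^+ 2 : R.
have SB : S <= C * (V ^+ 2 / m%:R + V * N).
  exact: (sum_sq_rich sp d1 uA uU (undup_uniq L)).
have XS : X ^+ 2 <= W2 * S.
  apply: le_trans (cauchy_schwarz _ _ _ _) _; rewrite ler_wpM2r ?sumr_ge0 // => [n _|].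
    exact: sqr_ge0.
  rewrite /W2 enE big_mkcond /=; apply: ler_sum => n _.
  by case: ifP => _; rewrite ?sqr_ge0.
have X0 : 0 <= X by apply: sumr_ge0 => n _; rewrite mulr_ge0 // ler0n.
have m0 : 0 < m%:R :> R by rewrite ltr0n.
have XB : X ^+ 2 * 16 <= t ^+ 2 * V ^+ 2 + 16 * C * W2 * (V * N).
  apply: (@le_trans _ _ (W2 * (C * (V ^+ 2 / m%:R + V * N)) * 16)).
    by rewrite ler_wpM2r // (le_trans XS) // ler_wpM2l.
  have -> : W2 * (C * (V ^+ 2 / m%:R + V * N)) * 16 =
     (16 * C * W2) * (V ^+ 2 / m%:R) + 16 * C * W2 * (V * N) by ring.
  rewrite lerD2r mulrA ler_pdivrMr //.
  have h : 16 * C * W2 <= t ^+ 2 * m%:R by rewrite -k0E mulrC ler_wpM2l ?ltW.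
  by have := ler_wpM2r (sqr_ge0 V) h; lra.
have h3 : 0 <= C * W2 * (N * t) by rewrite !mulr_ge0 // ltW.
have h4 : 0 <= C * W2 * W1 by rewrite !mulr_ge0.
have wCE : wC R d = 64 * C by [].
rewrite wCE; case: (leP (t * V) (2 * (k0 * W1))) => h.
  have h1 : t * V * t ^+ 2 <= 2 * (k0 * W1) * t ^+ 2 by rewrite ler_wpM2r // ltW.
  have h2 : 2 * (k0 * W1) * t ^+ 2 = 2 * W1 * (k0 * t ^+ 2) by ring.
  by move: h1; rewrite h2 k0E exprS; lra.
have hX : t * V <= 2 * X by move: mass split_mass; lra.
have hX2 : (t * V) ^+ 2 <= (2 * X) ^+ 2.
  by rewrite lerXn2r // nnegrE mulr_ge0 // ltW.
have hV : 3 * (t ^+ 2 * V) * V <= 16 * C * W2 * N * V.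
  by move: hX2 XB; rewrite !exprMn; lra.
have [V00|Vp] := leP V 0.
  have -> : V = 0 by apply/le_anti; rewrite V00 V0.
  by rewrite mul0r !mulr_ge0 // addr_ge0 // mulr_ge0 // ltW.
have hV' : 3 * (t ^+ 2 * V) <= 16 * C * W2 * N.
  by rewrite -(ler_pM2r Vp); move: hV; lra.
have := ler_wpM2r (ltW t0) hV'.
by rewrite exprS; lra.
Qed.



Lemma coinc_CS (R : realDomainType) (T : eqType) (L1 L2 : seq T) :
  (coinc L1 L2)%:R ^+ 2 <= (en L1)%:R * (en L2)%:R :> R.
Proof.
pose D := undup (L1 ++ L2).
have uD : uniq D := undup_uniq _.
have s1 : {subset L1 <= D} by move=> x; rewrite mem_undup mem_cat => ->.
have s2 : {subset L2 <= D} by move=> x; rewrite mem_undup mem_cat orbC => ->.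
rewrite /en /coinc !natr_sum (sum_count_uniq _ uD s1) (le_trans (cauchy_schwarz _ _ _ _)) //.
by rewrite (sum_count_uniq _ uD s1) (sum_count_uniq _ uD s2).
Qed.

Definition harmonic (R : realFieldType) (M : nat) : R := \sum_(0 <= i < M) (i.+1%:R)^-1.

Lemma harmonic_ge0 (R : realFieldType) M : 0 <= harmonic R M.
Proof. by apply: sumr_ge0 => i _; rewrite invr_ge0. Qed.

Lemma harmonic_mono (R : realFieldType) M M' : (M <= M')%N -> harmonic R M <= harmonic R M'.
Proof.
move=> MM; rewrite /harmonic [leRHS](big_cat_nat (leq0n M) MM) /= lerDl.
by apply: sumr_ge0 => i _; rewrite invr_ge0.
Qed.

Section Levels.
Variables (R : realType) (psi : {poly R}) (d : nat) (A : seq R) (L : seq (R * R)).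
Hypotheses (sp : size psi = d.+1) (d1 : (1 < d)%N) (uA : uniq A).
Variable M : nat.
Let B := madd L (pts psi A).
Let F u := count_mem u B.
Hypothesis FM : forall u, (F u <= M)%N.
Let N : R := (size A)%:R.
Let W1 : R := (size L)%:R.
Let W2 : R := (en L)%:R.
Let C : R := wC R d.

Let C0 : 0 <= C. Proof. by rewrite mulr_ge0. Qed.

Lemma level_count (i : nat) :
  (count (fun u => i < F u)%N (undup B))%:R <=
    C * W2 * (W1 / i.+1%:R ^+ 3 + N / i.+1%:R ^+ 2).
Proof.
have i0 : 0 < i.+1%:R :> R by rewrite ltr0n.
rewrite -size_filter; set U := filter _ _.
have uU : uniq U by rewrite filter_uniq // undup_uniq.
have := @level_set R psi d A L U i.+1%:R sp d1 uA uU i0.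
rewrite -/W1 -/W2 -/N -/C => h; rewrite -(ler_pM2r (exprn_gt0 3 i0)).
apply: le_trans (h _) _ => [u|].
  by rewrite mem_filter ler_nat => /andP[].
rewrite le_eqVlt; apply/orP; left; apply/eqP.
have : i.+1%:R != 0 :> R by rewrite gt_eqF.
by move: (i.+1%:R : R) => x x0; field.
Qed.

(** Multiplicities below [K] are paid for by the first moment W1 N. Above, the weights 2(i+1) turn
    the two terms of [level_count] into W1/(i+1)^2, with sum at most W1/K, and N/(i+1), the source
    of the logarithm. *)
Lemma energy_split (K : nat) : (0 < K)%N ->
  (en B)%:R <= K.-1%:R * (W1 * N) + 3 * C * W2 * (W1 / K%:R + N * (1 + harmonic R M)) :> R.
Proof.
case: K => // K _; set k := K.+1.
have W10 : 0 <= W1 by exact: ler0n.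
have W20 : 0 <= W2 by exact: ler0n.
have N0 : 0 <= N by exact: ler0n.
have CW : 0 <= C * W2 by rewrite mulr_ge0.
have kp : 0 < k%:R :> R by rewrite ltr0n.
have -> : (en B)%:R = \sum_(u <- undup B | ~~ (k <= F u)%N) (F u)%:R ^+ 2 +
    \sum_(u <- undup B | (k <= F u)%N) (F u)%:R ^+ 2 :> R.
  by rewrite enE (bigID (fun u => (k <= F u)%N)) addrC.
apply: lerD.
  have -> : W1 * N = \sum_(u <- undup B) (F u)%:R.
    transitivity ((size B)%:R : R); first by rewrite size_madd size_map natrM.
    by rewrite -sum1_size natr_sum sum_undupR; apply: eq_bigr => u _; rewrite mulr1.
  rewrite mulr_sumr big_mkcond /=; apply: ler_sum => u _.
  case: (leqP k (F u)) => h /=; first by rewrite mulr_ge0.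
  by rewrite expr2 ler_wpM2r // ler_nat.
have FD u : u \in undup B -> (F u <= M)%N by [].
rewrite (layer_cake (fun i => i%:R ^+ 2) k FD).
have t1 : k%:R ^+ 2 * (count (fun u => k <= F u)%N (undup B))%:R <=
    C * W2 * (W1 / k%:R + N).
  apply: le_trans (ler_wpM2l (sqr_ge0 _) (level_count K)) _.
  rewrite -/k le_eqVlt; apply/orP; left; apply/eqP.
  by have : k%:R != 0 :> R; [rewrite gt_eqF|move: (k%:R : R) => x x0; field].
have t2 : \sum_(k <= i < M) (i.+1%:R ^+ 2 - i%:R ^+ 2) *
      (count (fun u => i < F u)%N (undup B))%:R <=
    2 * (C * W2) * (W1 / k%:R + N * harmonic R M).
  apply: (@le_trans _ _ (\sum_(k <= i < M)
      2 * (C * W2) * (W1 * (i.+1%:R ^+ 2)^-1 + N * (i.+1%:R)^-1))).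
    apply: ler_sum_nat => i /andP[Ki _].
    have i0 : 0 < i.+1%:R :> R by rewrite ltr0n.
    apply: (@le_trans _ _ (2 * i.+1%:R * (count (fun u => i < F u)%N (undup B))%:R)).
      rewrite ler_wpM2r // -natr1; have := ler0n R i; nra.
    apply: le_trans (ler_wpM2l _ (level_count i)) _; first by rewrite mulr_ge0.
    rewrite le_eqVlt; apply/orP; left; apply/eqP.
    have : i.+1%:R != 0 :> R by rewrite gt_eqF.
    by move: (i.+1%:R : R) => x x0; field.
  rewrite -mulr_sumr ler_wpM2l ?mulr_ge0 // big_split /= -!mulr_sumr.
  apply: lerD; rewrite ler_wpM2l ?sum_inv_sqr //.
  have [kM|Mk] := leqP k M; last by rewrite big_geq ?harmonic_ge0 // ltnW.
  rewrite /harmonic [leRHS](big_cat_nat (leq0n k) kM) /= lerDr.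
  by apply: sumr_ge0 => i _; rewrite invr_ge0.
have t3 : 0 <= C * W2 * N * harmonic R M by rewrite !mulr_ge0 ?harmonic_ge0.
have t4 : 0 <= C * W2 * N by rewrite !mulr_ge0.
by move: t1 t2; lra.
Qed.

(** The weights are now 3(i+1)^2: the logarithm falls on W1, while the second term is constant in i
    and brings in the bound [M] on the multiplicities. *)
Lemma third_moment :
  \sum_(u <- undup B) (F u)%:R ^+ 3 <= 3 * C * W2 * (W1 * harmonic R M + N * M%:R).
Proof.
have W10 : 0 <= W1 by exact: ler0n.
have W20 : 0 <= W2 by exact: ler0n.
have CW : 0 <= C * W2 by rewrite mulr_ge0.
have FD u : u \in undup B -> (F u <= M)%N by [].
have := layer_cake (fun i => i%:R ^+ 3 : R) 0 FD => /=.
rewrite expr0n mul0r add0r => ->.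
apply: (@le_trans _ _ (\sum_(0 <= i < M) 3 * (C * W2) * (W1 * (i.+1%:R)^-1 + N))).
  apply: ler_sum_nat => i _.
  have i0 : 0 < i.+1%:R :> R by rewrite ltr0n.
  apply: (@le_trans _ _ (3 * i.+1%:R ^+ 2 * (count (fun u => i < F u)%N (undup B))%:R)).
    rewrite ler_wpM2r // -natr1; have := ler0n R i; nra.
  apply: le_trans (ler_wpM2l _ (level_count i)) _; first by rewrite mulr_ge0 ?sqr_ge0.
  rewrite le_eqVlt; apply/orP; left; apply/eqP.
  have : i.+1%:R != 0 :> R by rewrite gt_eqF.
  by move: (i.+1%:R : R) => x x0; field.
rewrite -mulr_sumr big_split /= -mulr_sumr sumr_const_nat subn0.
by rewrite -[N *+ M]mulr_natr -[3 * C * W2]mulrA.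
Qed.

Lemma energy_step : (0 < size A)%N -> (0 < size L)%N ->
  (en B)%:R <= (1 + 3 * C) * (W1 * Num.sqrt (W2 * N) + W2 * N * (1 + harmonic R M)).
Proof.
move=> A0 L0.
have W20' : 0 < W2.
  rewrite ltr0n; case: L L0 => // u L' _; rewrite /en /coinc big_cons /= eqxx.
  by rewrite addSn.
have N0' : 0 < N by rewrite ltr0n.
have W10 : 0 <= W1 by exact: ler0n.
have W20 := ltW W20'; have N0 := ltW N0'.
(* The threshold that balances k0 W1 N against W2 W1 / k0; both become W1 sqrt(W2 N). *)
pose k0 := Num.sqrt (W2 / N).
have k0p : 0 < k0 by rewrite sqrtr_gt0 divr_gt0.
have k0E : k0 * N = Num.sqrt (W2 * N).
  have -> : W2 * N = W2 / N * N ^+ 2 by field; rewrite gt_eqF.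
  by rewrite sqrtrM ?divr_ge0 // sqrtr_sqr ger0_norm.
have k0I : W2 / k0 = Num.sqrt (W2 * N).
  rewrite -k0E; apply: (mulIf (lt0r_neq0 k0p)); rewrite divfK ?lt0r_neq0 //.
  rewrite mulrAC -expr2 sqr_sqrtr ?divr_ge0 // divfK // gt_eqF //.
have [m1 m2] : (Num.trunc k0)%:R <= k0 /\ k0 < (Num.trunc k0).+1%:R.
  by have /andP[] := truncn_itv (ltW k0p).
have := energy_split (ltn0Sn (Num.trunc k0)); set K := (Num.trunc k0).+1 => h.
apply: le_trans h _; set q := Num.sqrt _ in k0E k0I *.
have q0 : 0 <= q := sqrtr_ge0 _.
have h1 : K.-1%:R * (W1 * N) <= W1 * q.
  rewrite -k0E; have := ler_wpM2r (mulr_ge0 W10 N0) m1; rewrite /K /=; lra.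
have h2 : W2 * (W1 / K%:R) <= W1 * q.
  rewrite mulrCA ler_wpM2l // -k0I ler_wpM2l // lef_pV2 ?posrE ?ltr0n //.
  exact: ltW.
have h3 := ler_wpM2l C0 h2.
have hh := harmonic_ge0 R M.
have h4 : 0 <= W2 * N * (1 + harmonic R M) by rewrite !mulr_ge0 // addr_ge0.
have h5 : 0 <= C * (W2 * N * (1 + harmonic R M)) by rewrite mulr_ge0.
by move: h1 h3; lra.
Qed.

End Levels.



(** * Sums and differences of multisets, and the energy of order two *)

Lemma coinc_perm (T : eqType) (L1 L1' L2 L2' : seq T) :
  perm_eq L1 L1' -> perm_eq L2 L2' -> coinc L1 L2 = coinc L1' L2'.
Proof.
move=> h1 /permP h2; rewrite /coinc (perm_big _ h1) /=.
by apply: eq_bigr => x _; rewrite h2.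
Qed.

Lemma en_perm (T : eqType) (L L' : seq T) : perm_eq L L' -> en L = en L'.
Proof. by move=> h; exact: coinc_perm. Qed.

Section Multisets.
Variable G : zmodType.
Implicit Types L : seq G.

Definition mopp L := map -%R L.

Lemma big_madd L1 L2 (f : G -> nat) : (\sum_(x <- madd L1 L2) f x =
  \sum_(x <- L1) \sum_(y <- L2) f (x + y)%R)%N.
Proof.
rewrite /madd; elim: L1 => [|x L1 IH] /=; first by rewrite !big_nil.
by rewrite big_cat big_map big_cons IH.
Qed.

Lemma maddA L1 L2 L3 : perm_eq (madd (madd L1 L2) L3) (madd L1 (madd L2 L3)).
Proof.
apply/permP => P; rewrite !count_madd big_madd.
apply: eq_bigr => x _; rewrite count_madd; apply: eq_bigr => y _.
by apply: eq_count => z /=; rewrite addrA.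
Qed.

Lemma maddC L1 L2 : perm_eq (madd L1 L2) (madd L2 L1).
Proof.
apply/permP => P; rewrite !count_madd.
under eq_bigr do rewrite -sum1_count big_mkcond /=.
under [RHS]eq_bigr do rewrite -sum1_count big_mkcond /=.
rewrite exchange_big /=; apply: eq_bigr => x _; apply: eq_bigr => y _.
by rewrite addrC.
Qed.

Lemma mopp_madd L1 L2 : mopp (madd L1 L2) = madd (mopp L1) (mopp L2).
Proof.
rewrite /mopp /madd map_allpairs allpairs_mapl allpairs_mapr.
by apply: eq_allpairs => x y; rewrite opprD.
Qed.

Lemma coincE L1 L2 : coinc L1 L2 = (\sum_(x <- L1) \sum_(y <- L2) (x == y))%N.
Proof.
rewrite /coinc; apply: eq_bigr => x _; rewrite -sum1_count big_mkcond /=.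
by apply: eq_bigr => y _; rewrite eq_sym; case: eqP.
Qed.

Lemma coinc_madd L1 L2 L3 L4 : coinc (madd L1 L2) (madd L3 L4) =
  (\sum_(x <- L1) \sum_(y <- L2) \sum_(z <- L3) \sum_(t <- L4) (x + y == z + t)%R)%N.
Proof.
rewrite coincE big_madd; apply: eq_bigr => x _; apply: eq_bigr => y _.
by rewrite big_madd.
Qed.

(** Because x - y = z - t exactly when x + t = z + y. In particular sums and differences have the
    same energy. *)
Lemma coinc_madd_opp L1 L2 L3 L4 :
  coinc (madd L1 (mopp L2)) (madd L3 (mopp L4)) = coinc (madd L1 L4) (madd L3 L2).
Proof.
rewrite !coinc_madd; apply: eq_bigr => x _; rewrite big_map.
under eq_bigr do under eq_bigr do rewrite big_map.
under [RHS]eq_bigr do rewrite exchange_big /=.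
rewrite [RHS]exchange_big /=; apply: eq_bigr => y _.
rewrite [RHS]exchange_big /=; apply: eq_bigr => z _; apply: eq_bigr => t _.
by rewrite subr_eq addrAC eq_sym subr_eq eq_sym.
Qed.

Lemma en_madd_opp L1 L2 : en (madd L1 (mopp L2)) = en (madd L1 L2).
Proof. exact: coinc_madd_opp. Qed.

Lemma en_le_sqr L : (en L <= size L ^ 2)%N.
Proof.
rewrite /en /coinc -sum1_size -mulnn big_distrl /=; apply: leq_sum => x _.
by rewrite mul1n sum1_size count_size.
Qed.

End Multisets.

(** The reflected point set is again part of a polynomial graph of the same degree, so the incidence
    bounds for sums also serve for differences. *)
Lemma mopp_pts (R : realType) (psi : {poly R}) (A : seq R) :
  mopp (pts psi A) = pts (- (psi \Po - 'X)) (mopp A).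
Proof.
rewrite /mopp /pts -!map_comp; apply: eq_map => x /=.
by rewrite /pt hornerN horner_comp !hornerE opprK.
Qed.

Lemma size_opp_comp (R : realType) (psi : {poly R}) :
  size (- (psi \Po - 'X)) = size psi.
Proof. by rewrite size_polyN size_comp_poly2 // size_polyN size_polyX. Qed.

Lemma uniq_mopp (G : zmodType) (A : seq G) : uniq (mopp A) = uniq A.
Proof. by rewrite map_inj_uniq //; exact: oppr_inj. Qed.

Lemma size_mopp (G : zmodType) (A : seq G) : size (mopp A) = size A.
Proof. exact: size_map. Qed.

Lemma count_shift_const (R : realType) (psi : {poly R}) (d : nat) (A : seq R) (h c : R) :
  size psi = d.+1 -> (1 < d)%N -> uniq A -> h != 0 ->
  (count (fun y => psi.[y + h] - psi.[y] == c)%R A <= d)%N.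
Proof.
move=> sp d1 uA h0; pose g := psi \Po ('X + h%:P) - psi - c%:P.
have gE t : g.[t] = psi.[t + h] - psi.[t] - c by rewrite !hornerE horner_comp !hornerE.
have sg : (size g <= d.+1)%N.
  apply: leq_trans (size_polyD _ _) _; rewrite geq_max !size_polyN.
  rewrite (leq_trans (size_polyC_leq1 _)) // andbT.
  apply: leq_trans (size_polyD _ _) _; rewrite geq_max size_polyN.
  by rewrite size_comp_poly2 ?size_XaddC // sp leqnn.
have g0 : g != 0.
  (* If [g] vanished, [psi] would agree with a line at all points k h; d+1 of them already force its
     degree down to at most 1. *)
  apply/eqP => g0.
  have [p0 lin] : exists p0, forall k, psi.[k%:R * h] = p0 + k%:R * c.
    exists psi.[0] => k; elim: k => [|k IH]; first by rewrite !mul0r addr0.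
    have := gE (k%:R * h); rewrite g0 horner0 IH => e.
    have -> : k.+1%:R * h = k%:R * h + h by rewrite -natr1 mulrDl mul1r.
    by rewrite -natr1; move: e; lra.
  pose q := psi - (p0%:P + (c / h) *: 'X).
  have q0 : q != 0.
    apply: contraTneq d1 => /eqP; rewrite subr_eq0 => /eqP e.
    have : (size psi <= 2)%N.
      rewrite e (leq_trans (size_polyD _ _)) // geq_max.
      rewrite (leq_trans (size_polyC_leq1 _)) //=.
      by rewrite (leq_trans (size_scale_leq _ _)) // size_polyX.
    by rewrite sp -leqNgt.
  have sq : (size q <= d.+1)%N.
    rewrite (leq_trans (size_polyD _ _)) // geq_max sp leqnn size_polyN /=.
    rewrite (leq_trans (size_polyD _ _)) // geq_max.
    rewrite (leq_trans (size_polyC_leq1 _)) //=.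
    by rewrite (leq_trans (size_scale_leq _ _)) // size_polyX ltnW.
  have := @max_poly_roots _ q [seq k%:R * h | k <- iota 0 d.+1] q0.
  rewrite size_map size_iota ltnNge sq => /(_ _ _)/negP; apply=> //.
    apply/allP => _ /mapP[k _ ->]; rewrite rootE.
    rewrite /q hornerD hornerN hornerD hornerC hornerZ hornerX lin.
    by apply/eqP; field.
  rewrite map_inj_uniq ?iota_uniq // => i j /(mulIf h0)/eqP.
  by rewrite eqr_nat => /eqP.
rewrite -size_filter -ltnS; apply: leq_trans sg; apply: max_poly_roots g0 _ _.
  apply/allP => y; rewrite mem_filter => /andP[/eqP e _].
  by rewrite rootE gE e subrr.
exact: filter_uniq.
Qed.

(** Counted through differences: off the diagonal [count_shift_const] allows at most [d]
    representations, and on it the zero difference has |A| of them. *)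
Lemma energy_two (R : realType) (psi : {poly R}) (d : nat) (A : seq R) :
  size psi = d.+1 -> (1 < d)%N -> uniq A ->
  (en (madd (pts psi A) (pts psi A)) <= d.+1 * size A ^ 2)%N.
Proof.
move=> sp d1 uA; rewrite -en_madd_opp /en /coinc.
rewrite big_madd /mopp -map_comp !big_map /=.
under eq_bigr do rewrite big_map.
have cnt x y : x != y ->
    (count_mem (pt psi x - pt psi y)%R (madd (pts psi A) (mopp (pts psi A))) <= d)%N.
  move=> xy; rewrite (permP (maddC _ _)) count_madd /mopp /pts -map_comp big_map.
  apply: leq_trans (count_shift_const (psi.[x] - psi.[y]) sp d1 uA (h := x - y) _); last first.
    by rewrite subr_eq0.
  rewrite -sum1_count [leqRHS]big_mkcond /=; apply: leq_sum => z _.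
  rewrite count_map; case: eqP => e.
    apply: (leq_trans (n := count_mem (z + (x - y))%R A)).
      apply: sub_count => t /= /eqP[<- _]; apply/eqP; ring.
    by rewrite count_uniq_mem // leq_b1.
  rewrite leqn0 -[_ == _]negbK -lt0n -has_count; apply/hasPn => t _ /=.
  apply/negP => /eqP[e1 e2]; apply: e; rewrite -e2 -e1.
  have -> : z + (- z + t) = t by ring.
  by ring.
apply: (@leq_trans (\sum_(x <- A) (size A + d * size A))%N).
  rewrite [leqLHS]big_seq [leqRHS]big_seq; apply: leq_sum => x xA.
  rewrite (bigD1_seq x) //=; apply: leq_add.
    rewrite subrr count_madd /pts big_map.
    rewrite -sum1_size; apply: leq_sum => y _.
    rewrite count_map.
    apply: (leq_trans (n := count_mem y A)).
      by apply: sub_count => t /= /eqP[/eqP]; rewrite subr_eq0 eq_sym.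
    by rewrite count_uniq_mem // leq_b1.
  apply: (@leq_trans (\sum_(y <- A) d)%N).
    rewrite [leqLHS]big_mkcond; apply: leq_sum => y _.
    case: eqVneq => //= xy; rewrite eq_sym in xy.
    by move: (cnt _ _ xy); rewrite /mopp -map_comp.
  by rewrite big_const_seq count_predT iter_addn_0.
by rewrite big_const_seq count_predT iter_addn_0 -mulSn -mulnA.
Qed.



(** * Iterated sums and the tuple count *)

Fixpoint ksum (G : zmodType) (L : seq G) (k : nat) : seq G :=
  if k is k'.+1 then madd (ksum L k') L else [:: 0].

Definition ffun_join (m n : nat) (T : finType)
    (y : {ffun 'I_m -> T} * {ffun 'I_n -> T}) : {ffun 'I_(m + n) -> T} :=
  [ffun i => match split i with inl j => y.1 j | inr j => y.2 j end].

Lemma sum_ffun_join (m n : nat) (T : finType) (F : {ffun 'I_(m + n) -> T} -> nat) :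
  (\sum_x F x = \sum_y \sum_z F (ffun_join (y, z)))%N.
Proof.
rewrite pair_bigA /= (reindex (@ffun_join m n T)) /=.
  by apply: eq_bigr => -[].
exists (fun x => ([ffun j => x (lshift n j)], [ffun j => x (rshift m j)])) => [[y z] _|x _].
  congr (_, _); apply/ffunP => j; rewrite !ffunE.
    by rewrite (unsplitK (inl j)).
  by rewrite (unsplitK (inr j)).
apply/ffunP => i; rewrite !ffunE; case: splitP => j e; rewrite ffunE; congr (x _);
  exact: val_inj.
Qed.

Lemma ffun_join_l m n (T : finType) (y : {ffun 'I_m -> T}) (z : {ffun 'I_n -> T}) i :
  ffun_join (y, z) (lshift n i) = y i.
Proof. by rewrite ffunE (unsplitK (inl i)). Qed.

Lemma ffun_join_r m n (T : finType) (y : {ffun 'I_m -> T}) (z : {ffun 'I_n -> T}) i :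
  ffun_join (y, z) (rshift m i) = z i.
Proof. by rewrite ffunE (unsplitK (inr i)). Qed.

Section Sums.
Variables (R : realType) (psi : {poly R}) (A : {fset R}).
Let P := pts psi (enum_fset A).

Definition tsum s (x : {ffun 'I_s -> A}) := \sum_i pt psi (val (x i)).

Lemma sum_A (F : R -> nat) : (\sum_(x <- enum_fset A) F x = \sum_(x : A) F (val x))%N.
Proof. by rewrite enum_fsetE big_map enumT. Qed.

Lemma sum_ksum s (F : R * R -> nat) :
  (\sum_(u <- ksum P s) F u = \sum_(x : {ffun 'I_s -> A}) F (tsum x))%N.
Proof.
elim: s F => [|s IH] F.
  pose e : {ffun 'I_0 -> A} := [ffun i : 'I_0 => False_rect A (notF (ltn_ord i))].
  rewrite /= big_seq1 (big_pred1 e); first by rewrite /tsum big_ord0.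
  by move=> x; apply/esym/eqP/ffunP; case.
rewrite /= big_madd IH -addn1 sum_ffun_join; apply: eq_bigr => y _.
rewrite /P /pts big_map sum_A.
rewrite (reindex (fun x : A => [ffun _ : 'I_1 => x])) /=.
  apply: eq_bigr => x _; congr F; rewrite /tsum big_split_ord /=; congr (_ + _).
    by apply: eq_bigr => i _; rewrite ffun_join_l.
  by rewrite big_ord1 ffun_join_r ffunE.
exists (fun z : {ffun 'I_1 -> A} => z ord0) => [x _|z _]; first by rewrite ffunE.
by apply/ffunP => i; rewrite ffunE (ord1 i).
Qed.

Lemma pair_sum (I : Type) (r : seq I) (f g : I -> R) :
  \sum_(i <- r) (f i, g i) = (\sum_(i <- r) f i, \sum_(i <- r) g i).
Proof. by elim: r => [|i r IH]; rewrite ?big_nil // !big_cons IH. Qed.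

Lemma energy2E s : energy2 s psi A = en (ksum P s).
Proof.
rewrite /energy2 -sum1_card big_mkcond /= sum_ffun_join /en coincE sum_ksum.
apply: eq_bigr => y _; rewrite sum_ksum; apply: eq_bigr => z _.
rewrite inE /tsum /pt !pair_sum xpair_eqE andbC.
under eq_bigr do rewrite ffun_join_l ffun_join_r.
under [X in _ && (X == 0)]eq_bigr do rewrite ffun_join_l ffun_join_r.
by rewrite !sumrB !subr_eq0; case: ifP.
Qed.

End Sums.

(** * The trace inequality *)



Lemma eq_subr_cross (G : zmodType) (a b c d : G) :
  (a - b == c - d) = (a + d == c + b).
Proof. by rewrite subr_eq addrAC eq_sym subr_eq eq_sym. Qed.

(* With [M = b b^T], [v] the all-one vector and [C = M b], the right-hand side
   is the Frobenius norm of [C]; it dominates [|C^T v|^2 / |v|^2], and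
   [|C^T v|^2 = v^T M^3 v] is bounded below by two Cauchy-Schwarz steps. *)
Lemma psd_trace (R : realDomainType) (I J : Type) (S : seq I) (X : seq J)
    (b : I -> J -> R) (M : I -> I -> R) :
  (forall s t, M s t = \sum_(u <- X) b s u * b t u) ->
  (\sum_(s <- S) \sum_(t <- S) M s t) ^+ 3 <= (size S)%:R ^+ 3 * \sum_(s <- S) \sum_(t <- S) \sum_(t' <- S) M s t * M s t' * M t t'.
Proof.
move=> ME; set tr := (X in _ <= _ * X); set E := (X in X ^+ 3 <= _).
set n : R := (size S)%:R; have n0 : 0 <= n by exact: ler0n.
have CS1 (f : I -> R) : (\sum_(s <- S) f s) ^+ 2 <= n * \sum_(s <- S) f s ^+ 2.
  have := cauchy_schwarz S predT (fun=> 1) f.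
  under eq_bigr do rewrite mul1r.
  move=> /le_trans; apply; rewrite ler_wpM2r ?sumr_ge0 // => [s _|]; first exact: sqr_ge0.
  by rewrite /n -sum1_size natr_sum; apply: ler_sum => s _; rewrite expr1n.
pose C s u := \sum_(t <- S) M s t * b t u.
pose m t := \sum_(s <- S) M s t.
pose w u := \sum_(s <- S) b s u.
pose c u := \sum_(s <- S) C s u.
have trE : tr = \sum_(u <- X) \sum_(s <- S) C s u ^+ 2.
  rewrite exchange_big; apply: eq_bigr => s _.
  under [RHS]eq_bigr do rewrite expr2 /C big_distrlr /=.
  rewrite [RHS]exchange_big; apply: eq_bigr => t _.
  rewrite [RHS]exchange_big; apply: eq_bigr => t' _.
  rewrite (ME t t') mulr_sumr; apply: eq_bigr => u _; ring.
have c2 : \sum_(u <- X) c u ^+ 2 <= n * tr.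
  by rewrite trE mulr_sumr; apply: ler_sum => u _; exact: CS1.
have Ew : E = \sum_(u <- X) w u ^+ 2.
  under [RHS]eq_bigr do rewrite expr2 /w big_distrlr /=.
  rewrite [RHS]exchange_big; apply: eq_bigr => s _.
  by rewrite [RHS]exchange_big; apply: eq_bigr => t _; rewrite ME.
have Em : E = \sum_(t <- S) m t by rewrite /E exchange_big.
have mE t : m t = \sum_(u <- X) b t u * w u.
  rewrite /m; under eq_bigr do rewrite ME.
  rewrite exchange_big; apply: eq_bigr => u _.
  by rewrite /w mulr_sumr; apply: eq_bigr => s _; rewrite mulrC.
have wc : \sum_(u <- X) w u * c u = \sum_(t <- S) m t ^+ 2.
  have cE u : c u = \sum_(t <- S) m t * b t u.
    rewrite /c /C exchange_big; apply: eq_bigr => t _.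
    by rewrite /m mulr_suml.
  under eq_bigr do rewrite cE mulr_sumr.
  rewrite exchange_big; apply: eq_bigr => t _.
  by rewrite expr2 [X in _ = _ * X]mE mulr_sumr; apply: eq_bigr => u _; ring.
have E0 : 0 <= E by rewrite Ew sumr_ge0 // => u _; exact: sqr_ge0.
have h1 : E ^+ 2 <= n * \sum_(t <- S) m t ^+ 2 by rewrite Em; exact: CS1.
have h2 : (\sum_(t <- S) m t ^+ 2) ^+ 2 <= E * (n * tr).
  rewrite -wc; apply: le_trans (cauchy_schwarz _ _ _ _) _.
  by rewrite -Ew ler_wpM2l.
have q0 : 0 <= \sum_(t <- S) m t ^+ 2 by apply: sumr_ge0 => t _; exact: sqr_ge0.
move: h1 h2 q0; set q := \sum_(t <- S) _ => h1 h2 q0.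
have h3 : (E ^+ 2) ^+ 2 <= (n * q) ^+ 2.
  by rewrite lerXn2r // nnegrE ?sqr_ge0 // mulr_ge0.
have h4 : E * E ^+ 3 <= E * (n ^+ 3 * tr).
  have := ler_wpM2l (sqr_ge0 n) h2; move: h3; rewrite exprMn; lra.
have [Ep|En] := ltP 0 E; first by rewrite -(ler_pM2l Ep).
have -> : E = 0 by apply/le_anti; rewrite En E0.
rewrite expr0n /= mulr_ge0 ?exprn_ge0 // trE.
by apply: sumr_ge0 => u _; apply: sumr_ge0 => s _; exact: sqr_ge0.
Qed.

Section Triples.
Variables (R : realType) (G : zmodType) (S : seq G).
Let B := madd S (mopp S).
Let X := undup B.
Let rn (t : G) : nat := count_mem t B.
Let r (t : G) : R := (rn t)%:R.
Let E : R := (en B)%:R.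
Let M3 : R := \sum_(x <- B) r x ^+ 2.

Let uX : uniq X. Proof. exact: undup_uniq. Qed.
Let r0 t : 0 <= r t. Proof. exact: ler0n. Qed.

Lemma mem_X t : (t \in X) = (t \in B).
Proof. exact: mem_undup. Qed.

Lemma rnE t : rn t = (\sum_(s <- S) \sum_(s' <- S) (s - s' == t)%R)%N.
Proof.
rewrite /rn count_madd; apply: eq_bigr => s _; rewrite /mopp count_map.
by rewrite -sum1_count big_mkcond; apply: eq_bigr => s' _ /=; case: eqP.
Qed.

Lemma rn_opp t : rn (- t) = rn t.
Proof.
rewrite !rnE exchange_big; apply: eq_bigr => s _; apply: eq_bigr => s' _.
by rewrite -eqr_opp opprB opprK.
Qed.

Lemma r_opp t : r (- t) = r t.
Proof. by rewrite /r rn_opp. Qed.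

Lemma mem_B s s' : s \in S -> s' \in S -> s - s' \in B.
Proof.
by move=> sS sS'; apply/allpairsP; exists (s, - s'); rewrite /= map_f.
Qed.

(** [r (s - t)] is a Gram matrix: [b s u] counts the s' with s - s' = u, so the sum over u counts
    the pairs with s - s' = t - t', that is s - t = s' - t'. Grouping its entries by difference
    shows that they add up to E. *)
Lemma trace_r : E ^+ 3 <= (size S)%:R ^+ 3 *
  \sum_(s <- S) \sum_(t <- S) \sum_(t' <- S) r (s - t) * r (s - t') * r (t - t').
Proof.
pose b (s u : G) : R := (count_mem (s - u) S)%:R.
have ME s t : s \in S -> t \in S -> \sum_(u <- X) b s u * b t u = r (s - t).
  move=> sS tS.
  have bE x u : b x u = \sum_(s' <- S) (x - s' == u)%:R.
    rewrite /b -sum1_count natr_sum big_mkcond; apply: eq_bigr => s' _ /=.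
    by rewrite [_ == x - u]eq_sym !subr_eq addrC; case: eqP.
  under eq_bigr do rewrite !bE big_distrlr /=.
  rewrite /r rnE natr_sum exchange_big; apply: eq_big_seq => s' s'S.
  rewrite exchange_big natr_sum; apply: eq_big_seq => t' t'S.
  rewrite (bigD1_seq (s - s')) ?uX ?mem_X ?mem_B //= eqxx mul1r big1 ?addr0.
    congr (nat_of_bool _)%:R.
    by rewrite !eq_subr_cross addrC.
  by move=> u; rewrite eq_sym => /negbTE ->; rewrite mul0r.
have := @psd_trace R _ _ S X b _ (fun s t => erefl).
set L := (X in X ^+ 3 <= _ -> _); set T := (X in _ <= _ * X -> _).
have -> : L = E.
  rewrite /L /E enE -/X.
  transitivity (\sum_(s <- S) \sum_(t <- S) r (s - t)).
    by apply: eq_big_seq => s sS; apply: eq_big_seq => t tS; exact: ME.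
  transitivity (\sum_(x <- B) r x); last first.
    by rewrite [LHS]sum_undupR; apply: eq_bigr => x _; rewrite expr2.
  have bE (f : G -> R) : \sum_(x <- B) f x = \sum_(s <- S) \sum_(t <- S) f (s - t).
    by rewrite /B /madd big_allpairs_dep; apply: eq_bigr => s _; rewrite /mopp big_map.
  by rewrite bE.
have -> // : T = \sum_(s <- S) \sum_(t <- S) \sum_(t' <- S) r (s - t) * r (s - t') * r (t - t').
apply: eq_big_seq => s sS; apply: eq_big_seq => t tS; apply: eq_big_seq => t' t'S.
by rewrite !ME.
Qed.

Let W : R := \sum_(a <- X) \sum_(b <- X) (r a * r b * r (a + b)) ^+ 2.

(** Two triples have the same consecutive differences exactly when one is a translate of the other,
    and a translation by x occurs in r(x)^3 ways. *)
Lemma en_triple :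
  let Q := [seq (q.1.1 - q.1.2, q.1.2 - q.2) | q <- [seq (q, s) | q <- [seq (s, t) | s <- S, t <- S], s <- S]] in
  (en Q)%:R = M3.
Proof.
move=> Q; rewrite /en coincE.
have bQ (f : G * G -> nat) : (\sum_(q <- Q) f q =
    \sum_(s <- S) \sum_(t <- S) \sum_(t' <- S) f (s - t, t - t')%R)%N.
  by rewrite /Q big_map !big_allpairs_dep /=.
rewrite bQ.
have -> : M3 = (\sum_(x <- B) rn x ^ 2)%N%:R.
  by rewrite natr_sum; apply: eq_bigr => x _; rewrite natrX.
congr _%:R; rewrite /B big_madd.
under [RHS]eq_bigr do rewrite /mopp big_map.
under [RHS]eq_bigr do under eq_bigr do rewrite -mulnn {1}rnE rnE big_distrlr /=.
apply: eq_bigr => s1 _.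
under eq_bigr do under eq_bigr do rewrite bQ.
under eq_bigr do rewrite exchange_big /=.
rewrite exchange_big; apply: eq_bigr => t1 _.
apply: eq_bigr => s2 _; apply: eq_bigr => s3 _.
rewrite big_distrlr /=; apply: eq_bigr => t2 _; apply: eq_bigr => t3 _.
rewrite xpair_eqE.
have -> : (s1 - s2 == t1 - t2) = (s2 - t2 == s1 - t1).
  by rewrite !eq_subr_cross eq_sym addrC.
case: eqP => [<-|_] //=; rewrite mul1n; congr (nat_of_bool _).
by rewrite !eq_subr_cross eq_sym addrC.
Qed.

Lemma trace_CS : (\sum_(s <- S) \sum_(t <- S) \sum_(t' <- S)
   r (s - t) * r (s - t') * r (t - t')) ^+ 2 <= M3 * W.
Proof.
set Q := [seq (q.1.1 - q.1.2, q.1.2 - q.2) | q <- [seq (q, s) | q <- [seq (s, t) | s <- S, t <- S], s <- S]].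
have bQ (f : G * G -> R) : \sum_(q <- Q) f q =
    \sum_(s <- S) \sum_(t <- S) \sum_(t' <- S) f (s - t, t - t').
  by rewrite /Q big_map !big_allpairs_dep /=.
pose phi (q : G * G) := r q.1 * r q.2 * r (q.1 + q.2).
have -> : \sum_(s <- S) \sum_(t <- S) \sum_(t' <- S)
    r (s - t) * r (s - t') * r (t - t') = \sum_(q <- Q) phi q.
  rewrite bQ; apply: eq_bigr => s _; apply: eq_bigr => t _; apply: eq_bigr => t' _.
  by rewrite /phi /= mulrAC addrA subrK.
pose XX := [seq (a, b) | a <- X, b <- X].
have uXX : uniq XX by rewrite allpairs_uniq // => -[? ?] [? ?] _ _ [-> ->].
have sQ : {subset Q <= XX}.
  move=> q /mapP[[[s t] t'] /allpairsP[[[a b] c] /= [/allpairsP[[a' b'] /= [h1 h2 [-> ->]]] h3 [-> -> ->]]] ->] /=.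
  by apply/allpairsP; exists (a' - b', b' - c); rewrite /= !mem_X !mem_B.
rewrite (sum_count_uniq _ uXX sQ).
apply: le_trans (cauchy_schwarz _ _ _ _) _.
rewrite -en_triple /en /coinc natr_sum (sum_count_uniq _ uXX sQ) -/Q.
by rewrite [X in _ * X <= _]big_allpairs_dep /=.
Qed.

(** As [r] is even, a + b may be traded for c = -(a + b). Summing over a + b + c = 0 is symmetric,
    so it becomes immaterial which of the three values of [r] is the smallest. *)
Definition zsum (F : G -> G -> G -> R) := \sum_(a <- X) \sum_(b <- X) \sum_(c <- X)
  ((a + b + c == 0)%:R * F a b c).

Definition Z (f g h : G -> R) := zsum (fun a b c => f a * g b * h c).

Lemma zsumD F F' : zsum (fun a b c => F a b c + F' a b c) = zsum F + zsum F'.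
Proof.
rewrite /zsum -big_split; apply: eq_bigr => a _; rewrite -big_split.
apply: eq_bigr => b _; rewrite -big_split; apply: eq_bigr => c _ /=.
exact: mulrDr.
Qed.

Lemma zsumZ k F : zsum (fun a b c => k * F a b c) = k * zsum F.
Proof.
rewrite /zsum mulr_sumr; apply: eq_bigr => a _; rewrite mulr_sumr; apply: eq_bigr => b _.
by rewrite mulr_sumr; apply: eq_bigr => c _ /=; rewrite mulrCA.
Qed.

Lemma zsum_le F F' : (forall a b c, F a b c <= F' a b c) -> zsum F <= zsum F'.
Proof.
move=> h; apply: ler_sum => a _; apply: ler_sum => b _; apply: ler_sum => c _.
exact: ler_wpM2l.
Qed.

Lemma ZC f g h : Z f g h = Z g f h.
Proof.
rewrite /Z /zsum exchange_big; apply: eq_bigr => a _; apply: eq_bigr => b _.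
by apply: eq_bigr => c _; rewrite (addrC b) (mulrC (f b)).
Qed.

Lemma ZA f g h : Z f g h = Z f h g.
Proof.
apply: eq_bigr => a _; rewrite exchange_big; apply: eq_bigr => b _.
by apply: eq_bigr => c _; rewrite addrAC mulrAC.
Qed.

Lemma Z_le_sum f g : (forall x, 0 <= f x) -> (forall x, 0 <= g x) ->
  Z f g (fun=> 1) <= (\sum_(a <- X) f a) * (\sum_(b <- X) g b).
Proof.
move=> f0 g0; rewrite /Z /zsum big_distrlr /=.
apply: ler_sum => a _; apply: ler_sum => b _.
have := @count_uniq_mem _ X (- (a + b)) uX.
rewrite -sum1_count big_mkcond /= => h.
under eq_bigr do rewrite mulr1.
rewrite -mulr_suml ler_piMl ?mulr_ge0 //.
apply: (@le_trans _ _ ((- (a + b) \in X)%:R)); last by case: (_ \in X).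
rewrite -h natr_sum; apply: ler_sum => c _.
by rewrite addrC addr_eq0; case: eqP.
Qed.

Lemma W_le_Z : W <= Z (fun x => r x ^+ 2) (fun x => r x ^+ 2) (fun x => r x ^+ 2).
Proof.
apply: ler_sum => a _; apply: ler_sum => b _.
have [abX|abX] := boolP (- (a + b) \in X).
  rewrite (bigD1_seq _ abX uX) /= subrr eqxx mul1r r_opp !exprMn lerDl.
  by apply: sumr_ge0 => c _; rewrite !mulr_ge0 ?sqr_ge0.
have -> : r (a + b) = 0.
  by rewrite -r_opp /r /rn; move: abX; rewrite mem_X => /count_memPn ->.
rewrite mulr0 expr0n /=; apply: sumr_ge0 => c _; by rewrite !mulr_ge0 ?sqr_ge0.
Qed.

Let rho x := r x ^+ 2.

Lemma sum_rho : \sum_(x <- X) rho x = E.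
Proof. by rewrite /E enE. Qed.

Variable dl : R.
Hypothesis dl0 : 0 <= dl.

(** r^(5/2), cut off below [dl]. In a product of three squares, one power of the smallest value is
    moved to the other two, half to each ([rho_triple]); the single power of [r] that remains makes
    the sum a count of coincidences. *)
Let g x := if dl <= r x then rho x * Num.sqrt (r x) else 0.

Lemma rho_triple (a b c : R) : 0 <= a -> 0 <= b -> 0 <= c ->
  a ^+ 2 * b ^+ 2 * c ^+ 2 <=
   (a ^+ 2 * Num.sqrt a) * (b ^+ 2 * Num.sqrt b) * c +
   a * (b ^+ 2 * Num.sqrt b) * (c ^+ 2 * Num.sqrt c) +
   (a ^+ 2 * Num.sqrt a) * b * (c ^+ 2 * Num.sqrt c).
Proof.
have main (x y z : R) : 0 <= x -> 0 <= y -> 0 <= z -> z <= x -> z <= y ->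
    x ^+ 2 * y ^+ 2 * z ^+ 2 <= (x ^+ 2 * Num.sqrt x) * (y ^+ 2 * Num.sqrt y) * z.
  move=> x0 y0 z0 zx zy.
  have zz : z <= Num.sqrt x * Num.sqrt y.
    rewrite -{1}(sqr_sqrtr z0) expr2; apply: ler_pM; rewrite ?sqrtr_ge0 //.
      by rewrite ler_wsqrtr.
    by rewrite ler_wsqrtr.
  have p0 : 0 <= x ^+ 2 * y ^+ 2 * z by rewrite !mulr_ge0 ?sqr_ge0.
  by have := ler_wpM2l p0 zz; lra.
move=> a0 b0 c0.
have t0 (x y z : R) : 0 <= x -> 0 <= y -> 0 <= z ->
    0 <= (x ^+ 2 * Num.sqrt x) * (y ^+ 2 * Num.sqrt y) * z.
  by move=> *; rewrite !mulr_ge0 ?sqrtr_ge0 ?sqr_ge0.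
have := t0 _ _ _ a0 b0 c0; have := t0 _ _ _ b0 c0 a0; have := t0 _ _ _ a0 c0 b0.
case: (leP c a) => ca; case: (leP c b) => cb.
- by have := main _ _ _ a0 b0 c0 ca cb; lra.
- by have := main _ _ _ a0 c0 b0 (le_trans (ltW cb) ca) (ltW cb); lra.
- by have := main _ _ _ b0 c0 a0 (le_trans (ltW ca) cb) (ltW ca); lra.
case: (leP a b) => ab.
  by have := main _ _ _ b0 c0 a0 ab (ltW ca); lra.
by have := main _ _ _ a0 c0 b0 (ltW ab) (ltW cb); lra.
Qed.

(** A value below [dl] contributes a factor at most dl^2; the other two arguments determine the
    third, and their squares sum to E each. *)
Lemma W_split : W <= 3 * dl ^+ 2 * E ^+ 2 + 3 * Z g g r.
Proof.
apply: le_trans W_le_Z _.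
have rho0 x : 0 <= rho x by exact: sqr_ge0.
have g0 x : 0 <= g x.
  by rewrite /g; case: ifP => // _; rewrite mulr_ge0 ?sqrtr_ge0.
have E0 : 0 <= E by exact: ler0n.
have pw a b c : rho a * rho b * rho c <=
    dl ^+ 2 * (rho a * rho b * 1) + (dl ^+ 2 * (rho a * 1 * rho c) +
    (dl ^+ 2 * (1 * rho b * rho c) + (g a * g b * r c + (r a * g b * g c + g a * r b * g c)))).
  have small x : r x < dl -> rho x <= dl ^+ 2.
    by move=> lt; rewrite lerXn2r ?nnegrE // ltW.
  have d0 : 0 <= dl ^+ 2 by exact: sqr_ge0.
  have p1 : 0 <= dl ^+ 2 * (rho a * rho b * 1) by rewrite !mulr_ge0.
  have p2 : 0 <= dl ^+ 2 * (rho a * 1 * rho c) by rewrite !mulr_ge0.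
  have p3 : 0 <= dl ^+ 2 * (1 * rho b * rho c) by rewrite !mulr_ge0.
  have p4 : 0 <= g a * g b * r c by rewrite !mulr_ge0.
  have p5 : 0 <= r a * g b * g c by rewrite !mulr_ge0.
  have p6 : 0 <= g a * r b * g c by rewrite !mulr_ge0.
  have [ha|/small ha] := leP dl (r a); last first.
    by have := ler_wpM2r (mulr_ge0 (rho0 b) (rho0 c)) ha; lra.
  have [hb|/small hb] := leP dl (r b); last first.
    by have := ler_wpM2r (mulr_ge0 (rho0 a) (rho0 c)) hb; lra.
  have [hc|/small hc] := leP dl (r c); last first.
    by have := ler_wpM2r (mulr_ge0 (rho0 a) (rho0 b)) hc; lra.
  have := rho_triple (r0 a) (r0 b) (r0 c); rewrite /g ha hb hc /rho => h.
  by move: p1 p2 p3; rewrite /rho; lra.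
apply: le_trans (zsum_le pw) _.
rewrite !zsumD !zsumZ -!/(Z _ _ _).
have z1 := Z_le_sum rho0 rho0; rewrite sum_rho in z1.
have z2 : Z rho (fun=> 1) rho <= E * E by rewrite ZA.
have z3 : Z (fun=> 1) rho rho <= E * E by rewrite ZC.
have -> : Z r g g = Z g g r by rewrite ZC ZA.
have -> : Z g r g = Z g g r by rewrite ZA.
have d0 : 0 <= dl ^+ 2 by exact: sqr_ge0.
have := ler_wpM2l d0 z1; have := ler_wpM2l d0 z2; have := ler_wpM2l d0 z3.
rewrite expr2; lra.
Qed.

Lemma Z_le_pairs : Z g g r <= \sum_(a <- X) \sum_(b <- X) g a * g b * r (a + b).
Proof.
have g0 x : 0 <= g x.
  by rewrite /g; case: ifP => // _; rewrite mulr_ge0 ?sqrtr_ge0 ?sqr_ge0.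
apply: ler_sum => a _; apply: ler_sum => b _.
have E1 c : (a + b + c == 0)%:R * (g a * g b * r c) =
    (c == - (a + b))%:R * (g a * g b * r (a + b)).
  rewrite addrC addr_eq0; case: eqP => [->|_]; last by rewrite !mul0r.
  by rewrite r_opp.
under eq_bigr do rewrite E1.
rewrite -mulr_suml ler_piMl ?mulr_ge0 //.
have := @count_uniq_mem _ X (- (a + b)) uX.
rewrite -sum1_count big_mkcond /= => h.
apply: (@le_trans _ _ ((- (a + b) \in X)%:R)); last by case: (_ \in X).
by rewrite -h natr_sum; apply: ler_sum => c _; case: eqP.
Qed.

Let lev x := trunc_log 2 (rn x).
Definition level i := [seq x <- X | lev x == i].

(** A representation a + b = s - s' is a coincidence a + s' = s - b between level + S and S - level,
    to which Cauchy-Schwarz applies. *)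
Lemma level_pairs i j :
  (\sum_(a <- level i) \sum_(b <- level j) r (a + b)) ^+ 2 <=
  (en (madd (level i) S))%:R * (en (madd (level j) S))%:R.
Proof.
have -> : \sum_(a <- level i) \sum_(b <- level j) r (a + b) =
    (coinc (madd (level i) S) (madd S (mopp (level j))))%:R.
  rewrite coinc_madd natr_sum; apply: eq_bigr => a _.
  transitivity ((\sum_(b <- level j) rn (a + b)%R)%N%:R : R); first by rewrite natr_sum.
  congr _%:R; under eq_bigr do rewrite rnE.
  under eq_bigr do rewrite exchange_big /=.
  rewrite exchange_big /=; apply: eq_bigr => s _.
  rewrite exchange_big /=; apply: eq_bigr => s' _.
  rewrite /mopp big_map; apply: eq_bigr => b _.
  by rewrite subr_eq addrAC [in RHS]eq_sym subr_eq.
apply: le_trans (coinc_CS _ _ _) _.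
by rewrite en_madd_opp -[in X in _ <= _ * X](en_perm (maddC _ _)).
Qed.

Lemma sum_level (J : nat) (f : G -> R) :
 (forall x, (rn x < 2 ^ J)%N) ->
  \sum_(x <- X) f x = \sum_(i < J) \sum_(x <- level i) f x.
Proof.
move=> rJ; under [RHS]eq_bigr do rewrite /level big_filter big_mkcond /=.
rewrite exchange_big /=; apply: eq_big_seq => x xX.
have lJ : (lev x < J)%N.
  have r1 : (0 < rn x)%N by rewrite -has_count has_pred1 -mem_X.
  rewrite -(ltn_exp2l _ _ (isT : 1 < 2)%N); apply: leq_ltn_trans (rJ x).
  exact: trunc_logP.
by rewrite (bigD1 (Ordinal lJ)) //= eqxx big1 ?addr0 // => i; rewrite -val_eqE /= eq_sym => /negbTE ->.
Qed.

Lemma pairs_le (J : nat) (Y : R) : 0 <= Y -> (forall x, (rn x < 2 ^ J)%N) ->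
  (forall i, dl < 2 ^+ i.+1 -> 2 ^+ (5 * i) * (en (madd (level i) S))%:R <= Y) ->
  \sum_(a <- X) \sum_(b <- X) g a * g b * r (a + b) <= J%:R ^+ 2 * (32 * Y).
Proof.
move=> Y0 rJ hY.
have g0 x : 0 <= g x.
  by rewrite /g; case: ifP => // _; rewrite mulr_ge0 ?sqrtr_ge0 ?sqr_ge0.
rewrite (sum_level (J := J)) //.
have -> : J%:R ^+ 2 * (32 * Y) = \sum_(i < J) \sum_(j < J) 32 * Y.
  by rewrite !sumr_const card_ord -mulrnA -[RHS]mulr_natl natrM expr2.
apply: ler_sum => i _.
have -> : \sum_(a <- level i) \sum_(b <- X) g a * g b * r (a + b) =
    \sum_(j < J) \sum_(a <- level i) \sum_(b <- level j) g a * g b * r (a + b).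
  rewrite [RHS]exchange_big; apply: eq_bigr => a _.
  by rewrite (sum_level (J := J)).
apply: ler_sum => j _.
(* An upper bound for [g] on level [i]; its square is 32 * 2^(5i), the origin of the factor 32. *)
pose Gm (i : nat) : R := Num.sqrt (2 ^+ (5 * i.+1)).
have rlev k x : x \in level k -> r x < 2 ^+ k.+1.
  rewrite mem_filter => /andP[/eqP <- _]; rewrite /r -natrX ltr_nat.
  exact: trunc_log_ltn.
have gG k x : x \in level k -> g x <= Gm k.
  move=> /rlev/ltW h; rewrite /g; case: ifP => _; last exact: sqrtr_ge0.
  rewrite -[rho x]ger0_norm ?sqr_ge0 // -sqrtr_sqr -sqrtrM ?sqr_ge0 //.
  rewrite ler_wsqrtr // /rho -exprM -exprSr [(5 * _)%N]mulnC [leRHS]exprM.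
  by rewrite (@lerXn2r _ 5) ?nnegrE ?exprn_ge0.
have gz k x : 2 ^+ k.+1 <= dl -> x \in level k -> g x = 0.
  by move=> h1 /rlev h2; rewrite /g leNgt (lt_le_trans h2 h1).
have Y32 : 0 <= 32 * Y by rewrite mulr_ge0.
have [hi|hi] := leP (2 ^+ i.+1) dl.
  rewrite big_seq big1 // => a ai; rewrite big1 // => b _.
  by rewrite (gz _ _ hi ai) !mul0r.
have [hj|hj] := leP (2 ^+ j.+1) dl.
  rewrite big1 // => a _; rewrite big_seq big1 // => b bj.
  by rewrite (gz _ _ hj bj) mulr0 mul0r.
have G0 k : 0 <= Gm k := sqrtr_ge0 _.
have Gsq k : Gm k ^+ 2 = 32 * 2 ^+ (5 * k).
  by rewrite sqr_sqrtr ?exprn_ge0 // mulnS exprD; congr (_ * _); ring.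
pose K := \sum_(a <- level i) \sum_(b <- level j) r (a + b).
have K0 : 0 <= K by apply: sumr_ge0 => a _; exact: sumr_ge0.
apply: (@le_trans _ _ (Gm i * Gm j * K)).
  rewrite /K mulr_sumr big_seq [leRHS]big_seq; apply: ler_sum => a ai.
  rewrite mulr_sumr big_seq [leRHS]big_seq; apply: ler_sum => b bj.
  by rewrite ler_wpM2r // ler_pM // gG.
have q0 : 0 <= Gm i * Gm j * K by rewrite !mulr_ge0.
rewrite -(@ler_pXn2r _ 2) ?nnegrE // !exprMn !Gsq.
have hi' := hY _ hi; have hj' := hY _ hj.
have e0 k : 0 <= 2 ^+ (5 * k) * (en (madd (level k) S))%:R :> R.
  by rewrite mulr_ge0 ?exprn_ge0.
have := ler_pM (e0 i) (e0 j) hi' hj'.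
have p0 : 0 <= 2 ^+ (5 * i) * 2 ^+ (5 * j) :> R by rewrite mulr_ge0 ?exprn_ge0.
have := ler_wpM2l p0 (level_pairs i j); rewrite -/K.
by move: (K ^+ 2) (2 ^+ _ : R) (2 ^+ _ : R) => k x y; lra.
Qed.

Lemma sixth_power_bound (J : nat) (Y : R) : 0 <= Y -> (forall x, (rn x < 2 ^ J)%N) ->
  (forall i, dl < 2 ^+ i.+1 -> 2 ^+ (5 * i) * (en (madd (level i) S))%:R <= Y) ->
  E ^+ 6 <= (size S)%:R ^+ 6 * (M3 * (3 * dl ^+ 2 * E ^+ 2 + 96 * (J%:R ^+ 2 * Y))).
Proof.
move=> Y0 rJ hY.
have M30 : 0 <= M3 by apply: sumr_ge0 => x _; exact: sqr_ge0.
have h1 := pairs_le Y0 rJ hY; have h2 := le_trans Z_le_pairs h1.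
have h3 : W <= 3 * dl ^+ 2 * E ^+ 2 + 96 * (J%:R ^+ 2 * Y).
  by apply: le_trans W_split _; rewrite lerD2l; move: h2; lra.
have h4 := le_trans trace_CS (ler_wpM2l M30 h3).
have E0 : 0 <= E by exact: ler0n.
have T0 : 0 <= \sum_(s <- S) \sum_(t <- S) \sum_(t' <- S) r (s - t) * r (s - t') * r (t - t').
  by do 3![apply: sumr_ge0 => ? _]; rewrite !mulr_ge0.
have := trace_r; move: T0 h4; set T := \sum_(s <- S) _ => T0 h4 h5.
have h6 : (E ^+ 3) ^+ 2 <= ((size S)%:R ^+ 3 * T) ^+ 2.
  by rewrite lerXn2r // nnegrE ?mulr_ge0 ?exprn_ge0.
have s6 : 0 <= (size S)%:R ^+ 6 :> R by rewrite exprn_ge0.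
rewrite -exprM exprMn -exprM in h6.
exact: le_trans h6 (ler_wpM2l s6 h4).
Qed.

End Triples.

(** * The power bounds *)



Section Powers.
Variables (R : realType) (N : R).
Hypothesis N1 : 1 <= N.

Lemma powR_base_gt0 : 0 < N. Proof. exact: lt_le_trans N1. Qed.

Lemma powRDp a b : N `^ (a + b) = N `^ a * N `^ b.
Proof. by rewrite powRD // (gt_eqF powR_base_gt0) implybT. Qed.

Lemma powRXp a k : (N `^ a) ^+ k = N `^ (a * k%:R).
Proof. by rewrite powRrM powR_mulrn ?powR_ge0. Qed.

Lemma natX_powR k : N ^+ k = N `^ k%:R.
Proof. by rewrite powR_mulrn // ltW ?powR_base_gt0. Qed.

Lemma sqrt_powR a : Num.sqrt (N `^ a) = N `^ (a / 2).
Proof. by rewrite -powR12_sqrt ?powR_ge0 // -powRrM. Qed.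

Lemma powR_ge1 a : 0 <= a -> 1 <= N `^ a.
Proof. by move=> a0; rewrite -(powRr0 N); exact: ler_powR. Qed.

End Powers.

Lemma harmonic_le_ln (R : realType) (M : nat) : (0 < M)%N -> harmonic R M <= 1 + ln (M%:R : R).
Proof.
elim: M => // M IH _; have [->|M0] := posnP M.
  by rewrite /harmonic big_nat1 invr1 ln1 addr0.
rewrite /harmonic big_nat_recr //= -/(harmonic R M).
have Mp : 0 < M%:R :> R by rewrite ltr0n.
have Mp1 : 0 < M.+1%:R :> R by rewrite ltr0n.
have h := IH M0.
have M1E : M.+1%:R = M%:R + 1 :> R by rewrite -natr1.
have e : M%:R = M.+1%:R * (1 - M.+1%:R^-1) :> R.
  by rewrite M1E; field; rewrite -M1E gt_eqF.
have lt1 : M.+1%:R^-1 < 1 :> R by rewrite invf_lt1 // ltr1n ltnS.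
have pos : 0 < 1 - M.+1%:R^-1 :> R by rewrite subr_gt0.
have := @le_ln1Dx R (- M.+1%:R^-1); rewrite ltrN2 => /(_ lt1) h2.
have : ln (M%:R : R) = ln M.+1%:R + ln (1 - M.+1%:R^-1) by rewrite {1}e lnM ?posrE.
move=> e2; rewrite e2 in h; apply: le_trans (lerD h (lexx _)) _.
by rewrite -!addrA lerD2l gerDl -lerBrDr sub0r.
Qed.

Lemma harmonic_powR (R : realType) (j : nat) (k : R) : 0 < k ->
  exists2 K : R, 0 <= K & forall n, (0 < n)%N -> 1 + harmonic R (n ^ j) <= K * n%:R `^ k.
Proof.
move=> k0; exists (2 + j%:R / k).
  by rewrite addr_ge0 // divr_ge0 // ltW.
move=> n n0; have n1 : 1 <= n%:R :> R by rewrite ler1n.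
have np : 0 < n%:R :> R by rewrite ltr0n.
have := @harmonic_le_ln R (n ^ j); rewrite expn_gt0 n0 => /(_ isT).
rewrite natrX lnXn // => h.
have h1 : 1 <= n%:R `^ k by rewrite powR_ge1 // ltW.
have h2 : k * ln n%:R <= n%:R `^ k.
  by rewrite -ln_powR ltW // ln_sublinear // powR_gt0.
have h3 : ln (n%:R : R) *+ j <= j%:R / k * n%:R `^ k.
  by rewrite -[ln _ *+ j]mulr_natl -mulrA ler_wpM2l // ler_pdivlMl.
by rewrite mulrDl; lra.
Qed.

(** [energy_step] in exponents: with W1 = N^s and W2 << N^a its terms have exponents s + (a+1)/2 and
    a + 1, the latter raised by [k] to absorb the logarithm. *)
Lemma step_powR (R : realType) (d s : nat) (K a b k : R) :
  (1 < d)%N -> 0 <= K -> 0 < k -> s%:R + (a + 1) / 2 <= b -> a + 1 + k <= b ->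
  exists2 K' : R, 0 <= K' & forall (psi : {poly R}) (A : seq R) (L : seq (R * R)),
    size psi = d.+1 -> uniq A -> (0 < size A)%N -> size L = (size A ^ s)%N ->
    (en L)%:R <= K * (size A)%:R `^ a ->
    (en (madd L (pts psi A)))%:R <= K' * (size A)%:R `^ b.
Proof.
move=> d1 K0 k0 b1 b2; have [H H0 Hh] := harmonic_powR s.+1 k0.
have C0 : 0 <= wC R d by rewrite mulr_ge0.
have K'0 : 0 <= (1 + 3 * wC R d) * (Num.sqrt K + K * H).
  by rewrite mulr_ge0 // addr_ge0 ?mulr_ge0 ?sqrtr_ge0.
exists ((1 + 3 * wC R d) * (Num.sqrt K + K * H)) => // psi A L sp uA A0 sL eL.
have L0 : (0 < size L)%N by rewrite sL expn_gt0 A0.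
have FM u : (count_mem u (madd L (pts psi A)) <= size A ^ s.+1)%N.
  by apply: leq_trans (count_size _ _) _; rewrite size_madd size_map sL expnSr.
apply: le_trans (energy_step sp d1 uA FM A0 L0) _.
rewrite -[leRHS]mulrA ler_wpM2l ?addr_ge0 ?mulr_ge0 // mulrDl.
have N1 : 1 <= (size A)%:R :> R by rewrite ler1n.
have Np := powR_base_gt0 N1.
move: eL; rewrite sL natrX; set N : R := (size A)%:R in N1 Np * => eL.
have e2 : (en L)%:R * N <= K * N `^ (a + 1).
  by rewrite powRDp // powRr1 ?(ltW Np) // mulrA ler_wpM2r // ltW.
apply: lerD.
  apply: (@le_trans _ _ (N ^+ s * (Num.sqrt K * N `^ ((a + 1) / 2)))).
    rewrite ler_wpM2l ?exprn_ge0 ?(ltW Np) // -sqrt_powR // -sqrtrM //.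
    by rewrite ler_wsqrtr.
  rewrite mulrCA natX_powR // -powRDp // ler_wpM2l ?sqrtr_ge0 //.
  exact: ler_powR.
apply: (@le_trans _ _ (K * N `^ (a + 1) * (H * N `^ k))).
  apply: ler_pM => //; [by rewrite mulr_ge0 // ltW | by rewrite addr_ge0 ?harmonic_ge0 | exact: Hh].
have -> : K * N `^ (a + 1) * (H * N `^ k) = K * H * N `^ (a + 1 + k).
  by rewrite [in RHS]powRDp //; ring.
by rewrite ler_wpM2l ?mulr_ge0 // ler_powR.
Qed.

Lemma ksum1 (G : zmodType) (P : seq G) : ksum P 1 = P.
Proof.
by rewrite /= /madd /= cats0 -[RHS]map_id; apply: eq_map => x; rewrite add0r.
Qed.

Lemma size_ksum (G : zmodType) (P : seq G) s : size (ksum P s) = (size P ^ s)%N.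
Proof. by elim: s => //= s IH; rewrite size_madd IH expnSr. Qed.

Lemma energy_three (R : realType) (d : nat) : (1 < d)%N ->
  exists2 K : R, 0 <= K & forall (psi : {poly R}) (A : seq R),
    size psi = d.+1 -> uniq A -> (0 < size A)%N ->
    (en (ksum (pts psi A) 3))%:R <= K * (size A)%:R `^ (7 / 2).
Proof.
move=> d1.
(* From the second energy the main exponent is exactly 2 + 3/2, so the logarithm attached to N^3 may
   cost as much as N^(1/2). *)
have k2 : 0 < 1 / 2 :> R by rewrite divr_gt0.
have b1 : 2%:R + (2 + 1) / 2 <= 7 / 2 :> R by lra.
have b2 : 2 + 1 + 1 / 2 <= 7 / 2 :> R by lra.
have [K K0 h] := step_powR d1 (ler0n R d.+1) k2 b1 b2.
exists K => // psi A sp uA A0.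
have -> : ksum (pts psi A) 3 = madd (ksum (pts psi A) 2) (pts psi A) by [].
apply: h => //; first by rewrite size_ksum size_map.
rewrite -[ksum _ 2]/(madd (ksum _ 1) _) ksum1.
rewrite powR_mulrn // -natrX -natrM ler_nat.
exact: energy_two.
Qed.



(** * The fourth energy *)

Lemma count_sub_le_en (G : zmodType) (S : seq G) (t : G) :
  (count_mem t (madd S (mopp S)) <= en S)%N.
Proof.
(* Representations of [t] are coincidences of [S] with its translate by [t], which has the same
   energy. *)
have -> : count_mem t (madd S (mopp S)) = coinc S (map (+%R t) S).
  rewrite count_madd; apply: eq_bigr => s _; rewrite /mopp !count_map.
  by apply: eq_count => s' /=; rewrite subr_eq eq_sym.
have := coinc_CS int S (map (+%R t) S).
have -> : en (map (+%R t) S) = en S.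
  rewrite /en /coinc big_map; apply: eq_bigr => s _; rewrite count_map.
  by apply: eq_count => s' /=; rewrite (inj_eq (addrI t)).
by rewrite -expr2 -!natrX ler_nat leq_sqr.
Qed.

Section Four.
Variables (R : realType) (d : nat) (psi : {poly R}) (A : seq R).
Hypotheses (sp : size psi = d.+1) (d1 : (1 < d)%N) (uA : uniq A) (A0 : (0 < size A)%N).
Let P := pts psi A.
Let S := madd P P.
Let B := madd S (mopp S).
Let N : R := (size A)%:R.
Let C : R := wC R d.
Let c : R := 1 + 3 * C.
(** One logarithmic factor for the whole section: no multiplicity that occurs exceeds |A|^6. *)
Let h : R := 1 + harmonic R (size A ^ 6).

Let N1 : 1 <= N. Proof. by rewrite ler1n. Qed.
Let Np : 0 < N. Proof. exact: lt_le_trans N1. Qed.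
Let C0 : 0 <= C. Proof. by rewrite mulr_ge0. Qed.
Let c1 : 1 <= c. Proof. by rewrite lerDl mulr_ge0. Qed.
Let h1 : 1 <= h. Proof. by rewrite lerDl harmonic_ge0. Qed.

(** Two incidence steps, from T to T + P to T + P + P, starting from the energy |T| of a set. In
    terms of the fourth roots [a] and [b] the square roots become polynomials. The 3 gathers a^6 b^8
    itself together with a^6 b^6 and a^4 b^8, both of which it dominates. *)
Lemma energy_add_two (T : seq (R * R)) (a b : R) : uniq T -> (0 < size T)%N ->
  (size T <= size A ^ 4)%N ->
  a = (size T)%:R `^ (1 / 4) -> b = N `^ (1 / 4) ->
  (en (madd T S))%:R <= c ^+ 2 * h ^+ 2 * (a ^+ 7 * b ^+ 7 + 3 * (a ^+ 6 * b ^+ 8)).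
Proof.
move=> uT T0 TA aE bE.
have -> : en (madd T S) = en (madd (madd T P) P).
  by apply: en_perm; rewrite perm_sym; exact: maddA.
have enT : en T = size T.
  rewrite /en /coinc -[RHS]sum1_size; apply: eq_big_seq => x xT.
  by rewrite count_uniq_mem // xT.
have sTP : size (madd T P) = (size T * size A)%N by rewrite size_madd size_map.
have sTPP : size (madd (madd T P) P) = (size T * size A ^ 2)%N.
  by rewrite size_madd sTP size_map -mulnA.
have hsle M : (M <= size A ^ 6)%N -> 1 + harmonic R M <= h.
  by move=> MA; rewrite lerD2l harmonic_mono.
have A1 k l : (k <= l)%N -> (size A ^ k <= size A ^ l)%N by move=> kl; rewrite leq_pexp2l.
have FM1 u : (count_mem u (madd T P) <= size A ^ 5)%N.
  apply: leq_trans (count_size _ _) _; rewrite sTP expnSr leq_mul2r TA orbT //.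
have FM2 u : (count_mem u (madd (madd T P) P) <= size A ^ 6)%N.
  apply: leq_trans (count_size _ _) _; rewrite sTPP.
  by rewrite -[6%N]/(4 + 2)%N expnD leq_mul2r TA orbT.
have s1 := energy_step sp d1 uA FM1 A0 T0.
have TP0 : (0 < size (madd T P))%N by rewrite sTP muln_gt0 T0.
have s2 := energy_step sp d1 uA FM2 A0 TP0.
move: s1 s2; rewrite enT sTP natrM -/N -/C -/c -/P; set x : R := (size T)%:R.
set e1 : R := (en (madd T P))%:R => s1 s2.
have a1 : 1 <= a by rewrite aE powR_ge1 // ?ler1n // divr_ge0.
have b1 : 1 <= b by rewrite bE powR_ge1 // divr_ge0.
have x0 : 0 <= x by exact: ler0n.
have xE : x = a ^+ 4 by rewrite aE powRXp ?ler1n // divfK ?pnatr_eq0 // powRr1.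
have NE : N = b ^+ 4 by rewrite bE powRXp // divfK ?pnatr_eq0 // powRr1 // ltW.
have a0 : 0 <= a by apply: le_trans a1.
have b0 : 0 <= b by apply: le_trans b1.
have c0 : 0 <= c by apply: le_trans c1.
have h0 : 0 <= h by apply: le_trans h1.
have sq1 : Num.sqrt (x * N) = a ^+ 2 * b ^+ 2.
  have -> : x * N = (a ^+ 2 * b ^+ 2) ^+ 2 by rewrite xE NE; ring.
  by rewrite sqrtr_sqr ger0_norm // mulr_ge0 ?exprn_ge0.
have e1B : e1 <= c * h * (a ^+ 6 * b ^+ 2 + a ^+ 4 * b ^+ 4).
  apply: le_trans s1 _; rewrite sq1 xE NE -[leRHS]mulrA ler_wpM2l // [leRHS]mulrDr.
  apply: lerD.
    have -> : a ^+ 4 * (a ^+ 2 * b ^+ 2) = 1 * (a ^+ 6 * b ^+ 2) by ring.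
    by rewrite ler_wpM2r // mulr_ge0 ?exprn_ge0.
  rewrite mulrC ler_wpM2r ?mulr_ge0 ?exprn_ge0 //.
  by apply: hsle; exact: A1.
have sq2 : Num.sqrt (e1 * N) <= c * h * (a ^+ 3 * b ^+ 3 + a ^+ 2 * b ^+ 4).
  have ch1 : 1 <= c * h by rewrite -[1]mulr1 ler_pM.
  have q0 : 0 <= a ^+ 3 * b ^+ 3 + a ^+ 2 * b ^+ 4.
    by rewrite addr_ge0 ?mulr_ge0 ?exprn_ge0.
  rewrite -[leRHS]ger0_norm; last by rewrite !mulr_ge0.
  rewrite -sqrtr_sqr ler_wsqrtr // exprMn.
  have k0 : 0 <= (a ^+ 6 * b ^+ 2 + a ^+ 4 * b ^+ 4) * N.
    by rewrite mulr_ge0 ?(ltW Np) // addr_ge0 ?mulr_ge0 ?exprn_ge0.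
  apply: (@le_trans _ _ (c * h * ((a ^+ 6 * b ^+ 2 + a ^+ 4 * b ^+ 4) * N))).
    by rewrite mulrA ler_wpM2r // ltW.
  apply: ler_pM => //; first by rewrite mulr_ge0.
    by rewrite expr2 ler_peMl // mulr_ge0.
  rewrite NE -subr_ge0.
  have -> : (a ^+ 3 * b ^+ 3 + a ^+ 2 * b ^+ 4) ^+ 2 -
    (a ^+ 6 * b ^+ 2 + a ^+ 4 * b ^+ 4) * b ^+ 4 = 2 * (a ^+ 5 * b ^+ 7) by ring.
  by rewrite !mulr_ge0 ?exprn_ge0.
apply: le_trans s2 _.
have t1 : x * N * Num.sqrt (e1 * N) <= c * h ^+ 2 * (a ^+ 7 * b ^+ 7 + a ^+ 6 * b ^+ 8).
  apply: (@le_trans _ _ (x * N * (c * h * (a ^+ 3 * b ^+ 3 + a ^+ 2 * b ^+ 4)))).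
    by rewrite ler_wpM2l // mulr_ge0 // ltW.
  have -> : x * N * (c * h * (a ^+ 3 * b ^+ 3 + a ^+ 2 * b ^+ 4)) =
     c * (h * (a ^+ 7 * b ^+ 7 + a ^+ 6 * b ^+ 8)) by rewrite xE NE; ring.
  rewrite -[leRHS]mulrA ler_wpM2l // ler_wpM2r ?addr_ge0 ?mulr_ge0 ?exprn_ge0 //.
  by rewrite expr2 ler_peMl.
have t2 : e1 * N * (1 + harmonic R (size A ^ 6)) <= c * h ^+ 2 * (2 * (a ^+ 6 * b ^+ 8)).
  apply: (@le_trans _ _ (c * h * (a ^+ 6 * b ^+ 2 + a ^+ 4 * b ^+ 4) * N * h)).
    by rewrite -/h ler_wpM2r // ler_wpM2r // ltW.
  have -> : c * h * (a ^+ 6 * b ^+ 2 + a ^+ 4 * b ^+ 4) * N * h =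
    c * h ^+ 2 * (a ^+ 6 * b ^+ 6 + a ^+ 4 * b ^+ 8) by rewrite NE; ring.
  rewrite ler_wpM2l ?mulr_ge0 ?sqr_ge0 // mulr_natl mulr2n; apply: lerD.
    by rewrite ler_wpM2l ?exprn_ge0 // ler_weXn2l.
  by rewrite ler_wpM2r ?exprn_ge0 // ler_weXn2l.
have t3 := ler_wpM2l c0 (lerD t1 t2).
by apply: le_trans t3 _; lra.
Qed.


Let E3 : R := (en (madd S P))%:R.
Let P' := pts (- (psi \Po - 'X)) (mopp A).
Let L' := madd S (mopp P).

(** Reading S - S as (S - P) - P makes it a list plus a reflected graph, and S - P has the energy
    [E3]. *)
Lemma B_perm : perm_eq B (madd L' P').
Proof.
rewrite /B /L' /P' -mopp_pts -/P {2}/S mopp_madd perm_sym; exact: maddA.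
Qed.

Lemma energy_two_real : (en S)%:R <= d.+1%:R * N ^+ 2 :> R.
Proof. by rewrite -natrX -natrM ler_nat; exact: energy_two. Qed.

(** The multiplicities in S - S are at most [en S], of order N^2, so the second term of
    [third_moment] stays at N^3 like the first. *)
Lemma third_moment_diff :
  \sum_(x <- B) (count_mem x B)%:R ^+ 2 <= 3 * C * E3 * (N ^+ 3 * h + N * (en S)%:R) :> R.
Proof.
have cE u : count_mem u (madd L' P') = count_mem u B by rewrite (permP B_perm).
have FM u : (count_mem u (madd L' P') <= en S)%N by rewrite cE count_sub_le_en.
have sp' : size (- (psi \Po - 'X)) = d.+1 by rewrite size_opp_comp.
have uA' : uniq (mopp A) by rewrite uniq_mopp.
have := third_moment sp' d1 uA' FM; rewrite -/P' size_mopp -/N -/C.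
have -> : (en L')%:R = E3 by rewrite /L' en_madd_opp.
have sL : size L' = (size A ^ 3)%N.
  by rewrite !size_madd /mopp !size_map; ring.
have -> : \sum_(u <- undup (madd L' P')) (count_mem u (madd L' P'))%:R ^+ 3 =
    \sum_(x <- B) (count_mem x B)%:R ^+ 2 :> R.
  rewrite (perm_big _ B_perm) /= [RHS]sum_undupR; apply: eq_bigr => u _.
  by rewrite cE exprS.
move=> hh; apply: le_trans hh _; rewrite sL natrX ler_wpM2l ?mulr_ge0 //.
rewrite lerD2r ler_wpM2l ?exprn_ge0 //.
apply: le_trans (harmonic_mono R (M' := (size A ^ 6)%N) _) _; last by rewrite lerDr.
apply: leq_trans (en_le_sqr _) _; rewrite size_madd !size_map.
by rewrite mulnn -expnM leq_pexp2l.
Qed.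

Lemma level_size i : (size (level S i))%:R * (2 ^+ i) ^+ 3 <=
  C * E3 * (N ^+ 3 + N * 2 ^+ i) :> R.
Proof.
have sp' : size (- (psi \Po - 'X)) = d.+1 by rewrite size_opp_comp.
have uA' : uniq (mopp A) by rewrite uniq_mopp.
have ul : uniq (level S i) by rewrite filter_uniq // undup_uniq.
have pos : 0 < 2 ^+ i :> R by rewrite exprn_gt0.
have := @level_set R _ d (mopp A) L' (level S i) (2 ^+ i) sp' d1 uA' ul pos.
rewrite size_mopp -/N -/C.
have -> : (en L')%:R = E3 by rewrite /L' en_madd_opp.
have -> : size L' = (size A ^ 3)%N.
  by rewrite !size_madd /mopp !size_map; ring.
rewrite natrX; apply=> u; rewrite mem_filter => /andP[/eqP <- uB].
rewrite -/P' -(permP B_perm) -natrX ler_nat; apply: trunc_logP => //.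
by rewrite -has_count has_pred1 -mem_undup.
Qed.

Section Numerics.
Variables (K3 H k : R).
Hypotheses (K30 : 0 <= K3) (hE3 : E3 <= K3 * N `^ (7 / 2)).
Let c2 : R := C * K3 * (d.+2)%:R + 1.

Let c20 : 0 <= C * K3 * (d.+2)%:R. Proof. by rewrite !mulr_ge0. Qed.
Let c21 : 1 <= c2. Proof. by rewrite lerDr. Qed.

Lemma level_size_powR i : (0 < size (level S i))%N ->
  (2 ^+ i <= d.+1%:R * N ^+ 2 :> R) /\
  (size (level S i))%:R * (2 ^+ i) ^+ 3 <= c2 * N `^ (13 / 2) :> R.
Proof.
move=> l0; have Di : 2 ^+ i <= d.+1%:R * N ^+ 2 :> R.
  case: (level S i) (fun u => mem_filter _ u _ : (u \in level S i) = _) l0 => // u l /(_ u).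
  rewrite mem_head => /esym/andP[/eqP <- uB] _.
  apply: le_trans energy_two_real; rewrite -natrX ler_nat.
  apply: leq_trans (count_sub_le_en _ u); apply: trunc_logP => //.
  by rewrite -has_count has_pred1 -mem_undup.
split=> //; apply: le_trans (level_size i) _.
apply: (@le_trans _ _ (C * (K3 * N `^ (7 / 2)) * (d.+2%:R * N ^+ 3))).
  apply: ler_pM; rewrite ?mulr_ge0 ?addr_ge0 ?exprn_ge0 ?mulr_ge0 ?exprn_ge0 ?(ltW Np) //.
    by rewrite ler_wpM2l.
  have := ler_wpM2l (ltW Np) Di; rewrite -[d.+2%:R]natr1 exprS; lra.
rewrite [N ^+ 3]natX_powR //.
have -> : C * (K3 * N `^ (7 / 2)) * (d.+2%:R * N `^ 3%:R) =
   C * K3 * d.+2%:R * N `^ (13 / 2).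
  rewrite [in RHS](_ : 13 / 2 = 7 / 2 + 3%:R) ?powRDp //; [by ring | by lra].
by rewrite ler_wpM2r ?powR_ge0 // lerDl.
Qed.

Let CY : R := c ^+ 2 * (2 * c2 ^+ 7 + 3 * c2 ^+ 6 * d.+1%:R).

(** With D = 2^i and g = D^(1/4), [level_size_powR] says a g^3 << N^(13/8). The terms of
    [energy_add_two] times D^5 are (a g^3)^7 b^7 / g and (a g^3)^6 g^2 b^8. The threshold bounds g
    from below and D << N^2 bounds it from above; the exponents are 91/8 + 7/4 - 9/32 = 411/32 and
    39/4 + 1 + 2, which is smaller. *)
Lemma level_energy i : N `^ (9 / 8) < 2 ^+ i.+1 ->
  2 ^+ (5 * i) * (en (madd (level S i) S))%:R <= CY * h ^+ 2 * N `^ (411 / 32).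
Proof.
have c0 : 0 <= c by apply: le_trans c1.
have h0 : 0 <= h by apply: le_trans h1.
have c20' : 0 <= c2 by apply: le_trans c21.
have CY0 : 0 <= CY.
  by rewrite mulr_ge0 ?sqr_ge0 // addr_ge0 ?mulr_ge0 ?exprn_ge0.
have [l0|l0] := posnP (size (level S i)).
  move=> _; move/size0nil: l0 => ->; rewrite /madd /= /en /coinc big_nil mulr0.
  exact: mulr_ge0 (mulr_ge0 CY0 (sqr_ge0 _)) (powR_ge0 _ _).
move=> Ddl; have [D1 D2] := level_size_powR l0.
have ul : uniq (level S i) by rewrite filter_uniq // undup_uniq.
have lA : (size (level S i) <= size A ^ 4)%N.
  rewrite size_filter (leq_trans (count_size _ _)) // (leq_trans (size_undup _)) //.
  by rewrite !size_madd size_mopp !size_madd !size_map !mulnn -expnM.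
have := energy_add_two ul l0 lA erefl erefl.
set a := (_ `^ (1 / 4)); set b := (N `^ (1 / 4)) => en_le.
set D : R := 2 ^+ i in D1 D2.
have Dp : 0 < D by rewrite exprn_gt0.
have D0 := ltW Dp.
pose g := D `^ (1 / 4).
have gp : 0 < g by rewrite powR_gt0.
have g0 := ltW gp.
have a0 : 0 <= a := powR_ge0 _ _.
have b0 : 0 <= b := powR_ge0 _ _.
have xE : (size (level S i))%:R = a ^+ 4.
  by rewrite /a -powR_mulrn ?powR_ge0 // -powRrM divfK ?pnatr_eq0 // powRr1.
have DE : D = g ^+ 4.
  by rewrite /g -powR_mulrn ?powR_ge0 // -powRrM divfK ?pnatr_eq0 // powRr1.
have bE m : b ^+ m = N `^ (m%:R / 4).
  by rewrite /b powRXp // mulrC mul1r.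
have ag : a * g ^+ 3 <= c2 * N `^ (13 / 8).
  rewrite -(@ler_pXn2r _ 4) ?nnegrE ?mulr_ge0 ?exprn_ge0 ?powR_ge0 //.
  have -> : (a * g ^+ 3) ^+ 4 = a ^+ 4 * (g ^+ 4) ^+ 3 by ring.
  rewrite -xE -DE (le_trans D2) // exprMn powRXp //.
  have -> : 13 / 8 * 4%:R = 13 / 2 :> R by lra.
  by rewrite ler_wpM2r ?powR_ge0 // ler_eXnr.
have g_low : N `^ (9 / 32) <= 2 * g.
  rewrite -(@ler_pXn2r _ 4) ?nnegrE ?mulr_ge0 ?powR_ge0 //.
  rewrite powRXp // exprMn -DE.
  have -> : 9 / 32 * 4%:R = 9 / 8 :> R by lra.
  by move: Ddl; rewrite exprS -/D; lra.
have g_up : g ^+ 2 <= d.+1%:R * N.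
  rewrite -(@ler_pXn2r _ 2) ?nnegrE ?mulr_ge0 ?exprn_ge0 ?(ltW Np) //.
  rewrite -exprM -DE (le_trans D1) // exprMn ler_wpM2r ?sqr_ge0 //.
  by rewrite ler_eXnr // ler1n.
set q := c2 * N `^ (13 / 8) in ag.
have q0 : 0 <= q by rewrite mulr_ge0 ?powR_ge0.
have ag0 : 0 <= a * g ^+ 3 by rewrite mulr_ge0 ?exprn_ge0.
have ag7 : (a * g ^+ 3) ^+ 7 <= q ^+ 7 by rewrite (@lerXn2r _ 7) ?nnegrE.
have ag6 : (a * g ^+ 3) ^+ 6 <= q ^+ 6 by rewrite (@lerXn2r _ 6) ?nnegrE.
have D5 : 2 ^+ (5 * i) = g ^+ 20.
  by rewrite mulnC exprM -/D DE -exprM.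
have qE m : q ^+ m = c2 ^+ m * N `^ (13 / 8 * m%:R) by rewrite exprMn powRXp.
have f1 : g ^+ 20 * (a ^+ 7 * b ^+ 7) <= 2 * c2 ^+ 7 * N `^ (411 / 32).
  have gE : g ^+ 20 * (a ^+ 7 * b ^+ 7) * g = (a * g ^+ 3) ^+ 7 * b ^+ 7 by ring.
  rewrite -(ler_pM2r gp) gE.
  apply: (@le_trans _ _ (q ^+ 7 * b ^+ 7)); first by rewrite ler_wpM2r ?exprn_ge0.
  rewrite qE bE.
  apply: (@le_trans _ _ (c2 ^+ 7 * N `^ (411 / 32) * N `^ (9 / 32))).
    by rewrite -[leLHS]mulrA -[leRHS]mulrA -!powRDp // ler_wpM2l ?exprn_ge0 // ler_powR //; lra.
  have p0 : 0 <= c2 ^+ 7 * N `^ (411 / 32) by rewrite mulr_ge0 ?exprn_ge0 ?powR_ge0.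
  by have := ler_wpM2l p0 g_low; lra.
have f2 : g ^+ 20 * (a ^+ 6 * b ^+ 8) <= c2 ^+ 6 * d.+1%:R * N `^ (411 / 32).
  have gE : g ^+ 20 * (a ^+ 6 * b ^+ 8) = (a * g ^+ 3) ^+ 6 * (g ^+ 2 * b ^+ 8) by ring.
  rewrite gE.
  apply: (@le_trans _ _ (q ^+ 6 * (d.+1%:R * N * b ^+ 8))).
    apply: ler_pM; rewrite ?exprn_ge0 ?mulr_ge0 ?exprn_ge0 //.
    by rewrite ler_wpM2r ?exprn_ge0.
  rewrite qE bE.
  have -> : c2 ^+ 6 * N `^ (13 / 8 * 6%:R) * (d.+1%:R * N * N `^ (8%:R / 4)) =
     c2 ^+ 6 * d.+1%:R * (N `^ (13 / 8 * 6%:R) * N `^ 1 * N `^ (8%:R / 4)).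
    by rewrite powRr1 ?(ltW Np) //; ring.
  rewrite -!powRDp // ler_wpM2l ?mulr_ge0 ?exprn_ge0 // ler_powR //; lra.
rewrite D5.
apply: (@le_trans _ _ (g ^+ 20 * (c ^+ 2 * h ^+ 2 * (a ^+ 7 * b ^+ 7 + 3 * (a ^+ 6 * b ^+ 8))))).
  by rewrite ler_wpM2l ?exprn_ge0.
have ch0 : 0 <= c ^+ 2 * h ^+ 2 by rewrite mulr_ge0 ?sqr_ge0.
have := ler_wpM2l ch0 f1; have := ler_wpM2l ch0 f2.
rewrite /CY; move: (N `^ (411 / 32)) (c2 ^+ 7) (c2 ^+ 6) (g ^+ 20) (a ^+ 7 * b ^+ 7) (a ^+ 6 * b ^+ 8) => *; lra.
Qed.

End Numerics.
End Four.



Lemma trunc_log_powR (R : realType) (k : R) : 0 < k ->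
  exists2 K : R, 0 <= K &
    forall n, (0 < n)%N -> (trunc_log 2 (n ^ 4)).+1%:R <= K * n%:R `^ k.
Proof.
move=> k0; have l2 : 0 < ln (2 : R) by rewrite ln_gt0 // ltr1n.
have kl : 0 < k * ln 2 by rewrite mulr_gt0.
exists (1 + 4 / (k * ln 2)).
  by rewrite addr_ge0 // divr_ge0 // ltW.
move=> n n0; have n1 : 1 <= n%:R :> R by rewrite ler1n.
have np : 0 < n%:R :> R by rewrite ltr0n.
have h1 : 1 <= n%:R `^ k by rewrite powR_ge1 // ltW.
have h2 : k * ln n%:R <= n%:R `^ k.
  by rewrite -ln_powR ltW // ln_sublinear // powR_gt0.
set t := trunc_log _ _.
have h3 : ln (2 : R) * t%:R <= 4 * ln n%:R.
  have : 2 ^+ t <= n%:R ^+ 4 :> R.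
    by rewrite -!natrX ler_nat trunc_logP // expn_gt0 n0.
  rewrite -ler_ln ?posrE ?exprn_gt0 // !lnXn //.
  by rewrite -[ln 2 *+ t]mulr_natr -[ln n%:R *+ 4]mulr_natl.
have h4 : t%:R <= 4 / (k * ln 2) * n%:R `^ k.
  rewrite mulrAC ler_pdivlMr //.
  have := ler_wpM2l (ltW k0) h3; move: h2; lra.
by rewrite -natr1 mulrDl; lra.
Qed.

(** If E exceeded 2 c z, then c z^4 <= E^4 / 16 and c z^6 < E^6 / 64, and the right-hand side would
    fall short of E^6. *)
Lemma sixth_power_solve (R : realFieldType) (E c z : R) : 0 <= E -> 1 <= c -> 0 < z ->
  E ^+ 6 <= c * (z ^+ 4 * E ^+ 2 + z ^+ 6) -> E <= 2 * c * z.
Proof.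
move=> E0 c1 z0 h; rewrite leNgt; apply/negP => lt.
have c0 : 0 < c by apply: lt_le_trans c1.
have w0 : 0 <= 2 * c * z by rewrite !mulr_ge0 // ltW.
have Ep : 0 < E by apply: le_lt_trans lt.
have c4 : c <= c ^+ 4 by rewrite ler_eXnr.
have c6 : c <= c ^+ 6 by rewrite ler_eXnr.
have h4 : (2 * c * z) ^+ 4 <= E ^+ 4 by rewrite lerXn2r // ?nnegrE // ltW.
have h6 : (2 * c * z) ^+ 6 < E ^+ 6 by rewrite ltrXn2r // ?nnegrE // ltW.
have z4 : 0 <= z ^+ 4 by rewrite exprn_ge0 // ltW.
have z6 : 0 < z ^+ 6 by rewrite exprn_gt0.
have e2 : 0 <= E ^+ 2 := sqr_ge0 E.
have k1 : 16 * (c * z ^+ 4) <= E ^+ 4.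
  apply: le_trans h4; rewrite !exprMn; have := ler_wpM2r z4 c4; lra.
have k2 : 64 * (c * z ^+ 6) < E ^+ 6.
  apply: le_lt_trans h6; rewrite !exprMn; have := ler_wpM2r (ltW z6) c6; lra.
have k3 := ler_wpM2r e2 k1.
have k4 : E ^+ 4 * E ^+ 2 = E ^+ 6 by rewrite -exprD.
have k5 : 0 < c * z ^+ 6 by rewrite mulr_gt0.
have k6 : 0 <= c * z ^+ 4 * E ^+ 2 by rewrite !mulr_ge0 // ltW.
by move: h k3; rewrite k4; lra.
Qed.

Lemma ksum4_perm (G : zmodType) (P : seq G) :
  en (ksum P 4) = en (madd (madd P P) (mopp (madd P P))).
Proof.
rewrite en_madd_opp; apply: en_perm.
rewrite -[ksum P 4]/(madd (madd (madd (ksum P 1) P) P) P) ksum1; exact: maddA.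
Qed.

Lemma energy_four (R : realType) (d : nat) : (1 < d)%N ->
  exists2 K : R, 0 <= K & forall (psi : {poly R}) (A : seq R),
    size psi = d.+1 -> uniq A -> (0 < size A)%N ->
    (en (ksum (pts psi A) 4))%:R <= K * (size A)%:R `^ (131 / 25).
Proof.
(* Five factors N^k arise: one in the third moment, two from h^2 and two from the squared number of
   levels. They fit, since 1003/32 + 5/100 <= 6 * 131/25. *)
move=> d1; pose k : R := 1 / 100.
have k0 : 0 < k by rewrite divr_gt0.
have [K3 K30 hK3] := energy_three R d1.
have [H H0 hH] := harmonic_powR 6 k0.
have [J J0 hJ] := trunc_log_powR k0.
pose C : R := wC R d; have C0 : 0 <= C by rewrite mulr_ge0.
pose c : R := 1 + 3 * C.
pose c2 : R := C * K3 * d.+2%:R + 1.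
have c20 : 0 <= c2 by rewrite addr_ge0 // !mulr_ge0.
have c0 : 0 <= c by rewrite addr_ge0 // mulr_ge0.
pose CY : R := c ^+ 2 * (2 * c2 ^+ 7 + 3 * c2 ^+ 6 * d.+1%:R).
have CY0 : 0 <= CY by rewrite mulr_ge0 ?sqr_ge0 // addr_ge0 // !mulr_ge0 // ?exprn_ge0.
pose c3 : R := 3 * C * K3 * (H + d.+1%:R).
have c30 : 0 <= c3 by rewrite !mulr_ge0 // addr_ge0.
pose c4 : R := c3 * 3 + c3 * (96 * (J ^+ 2 * (CY * H ^+ 2))) + 1.
have q0 : 0 <= c3 * (96 * (J ^+ 2 * (CY * H ^+ 2))).
  by apply: (mulr_ge0 c30); apply: mulr_ge0 => //; apply: mulr_ge0 (sqr_ge0 _) (mulr_ge0 CY0 (sqr_ge0 _)).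
have c41 : 1 <= c4 by rewrite lerDr addr_ge0 // mulr_ge0.
exists (2 * c4); first by rewrite mulr_ge0 // (le_trans _ c41).
move=> psi A sp uA A0; set N : R := (size A)%:R.
have N1 : 1 <= N by rewrite ler1n.
have Np : 0 < N by apply: lt_le_trans N1.
have pw0 e : 0 <= N `^ e := powR_ge0 _ _.
set P := pts psi A; pose S := madd P P; pose B := madd S (mopp S).
rewrite ksum4_perm -/S -/B; set E : R := (en B)%:R.
have hE3 : (en (madd S P))%:R <= K3 * N `^ (7 / 2).
  by have := hK3 psi A sp uA A0; rewrite -[ksum _ 3]/(madd (madd (ksum P 1) P) P) ksum1.
pose h : R := 1 + harmonic R (size A ^ 6).
have hh : h <= H * N `^ k := hH _ A0.
have h1 : 1 <= h by rewrite lerDl harmonic_ge0.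
have h0 : 0 <= h by apply: le_trans h1.
set M3 : R := \sum_(x <- B) (count_mem x B)%:R ^+ 2.
have M30 : 0 <= M3 by apply: sumr_ge0 => x _; exact: sqr_ge0.
have N3 : N ^+ 3 = N `^ 3%:R by exact: natX_powR.
have M3B : M3 <= c3 * N `^ (13 / 2 + k).
  apply: le_trans (third_moment_diff sp d1 uA A0) _; rewrite -/P -/S -/C -/N -/h.
  have t1 : N ^+ 3 * h + N * (en S)%:R <= (H + d.+1%:R) * (N `^ 3%:R * N `^ k).
    have e2 := energy_two_real sp d1 uA; rewrite -/P -/S -/N in e2.
    have a1 : N ^+ 3 * h <= N ^+ 3 * (H * N `^ k) by rewrite ler_wpM2l ?exprn_ge0 // ltW.
    have a2 : N * (en S)%:R <= N * (d.+1%:R * N ^+ 2) by rewrite ler_wpM2l // ltW.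
    have a3 : d.+1%:R * N ^+ 3 * 1 <= d.+1%:R * N ^+ 3 * N `^ k.
      by rewrite ler_wpM2l ?mulr_ge0 ?exprn_ge0 ?(ltW Np) // powR_ge1 // ltW.
    by move: a1 a2 a3; rewrite -N3 !exprS; lra.
  have t2 : 3 * C * (en (madd S P))%:R <= 3 * C * K3 * N `^ (7 / 2).
    by rewrite -[leRHS]mulrA ler_wpM2l // mulr_ge0.
  apply: (@le_trans _ _ (3 * C * K3 * N `^ (7 / 2) * ((H + d.+1%:R) * (N `^ 3%:R * N `^ k)))).
    apply: ler_pM => //; first by rewrite !mulr_ge0.
    by rewrite addr_ge0 ?mulr_ge0 ?exprn_ge0 // ltW.
  have -> : 13 / 2 + k = 7 / 2 + (3%:R + k) by lra.
  by rewrite !powRDp // /c3 le_eqVlt; apply/orP; left; apply/eqP; ring.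
pose Y : R := CY * h ^+ 2 * N `^ (411 / 32).
have Y0 : 0 <= Y by rewrite mulr_ge0 // mulr_ge0 // sqr_ge0.
have hY i : N `^ (9 / 8) < 2 ^+ i.+1 -> 2 ^+ (5 * i) * (en (madd (level S i) S))%:R <= Y.
  exact: (level_energy sp d1 uA A0 K30 hE3).
set j := (trunc_log 2 (size A ^ 4)).+1.
have rJ x : (count_mem x B < 2 ^ j)%N.
  apply: leq_ltn_trans (count_sub_le_en _ _) _; apply: leq_ltn_trans (en_le_sqr _) _.
  rewrite size_madd !size_map mulnn -expnM; exact: trunc_log_ltn.
have jB : j%:R <= J * N `^ k := hJ _ A0.
have := sixth_power_bound (pw0 (9 / 8)) Y0 rJ hY; rewrite -/E -/M3.
have -> : (size S)%:R ^+ 6 = N `^ 12%:R.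
  rewrite size_madd !size_map natrM -expr2 -exprM; exact: natX_powR.
move=> main.
have YB : Y <= CY * H ^+ 2 * N `^ (411 / 32 + k * 2%:R).
  have : h ^+ 2 <= (H * N `^ k) ^+ 2 by rewrite lerXn2r // ?nnegrE // mulr_ge0.
  rewrite exprMn powRXp // powRDp // => hsq.
  have := ler_wpM2l (mulr_ge0 CY0 (pw0 (411 / 32))) hsq; rewrite /Y; lra.
have JB : j%:R ^+ 2 <= J ^+ 2 * N `^ (k * 2%:R).
  rewrite -powRXp // -exprMn lerXn2r // ?nnegrE // mulr_ge0 //.
have JY : j%:R ^+ 2 * Y <= J ^+ 2 * (CY * H ^+ 2) * N `^ (k * 2%:R + (411 / 32 + k * 2%:R)).
  apply: le_trans (ler_pM _ _ JB YB) _; rewrite ?sqr_ge0 //.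
  by rewrite [N `^ (k * 2%:R + (_ + _))]powRDp // le_eqVlt; apply/orP; left; apply/eqP; ring.
have E0 : 0 <= E by exact: ler0n.
set z := N `^ (131 / 25).
have zp : 0 < z by rewrite powR_gt0.
apply: (@sixth_power_solve _ E c4 z) => //.
apply: le_trans main _.
have E20 : 0 <= E ^+ 2 := sqr_ge0 _.
have b1 : N `^ 12%:R * (N `^ (13 / 2 + k) * (N `^ (9 / 8)) ^+ 2) <= z ^+ 4.
  rewrite /z !powRXp // -!powRDp // ler_powR // /k; lra.
have b2 : N `^ 12%:R * (N `^ (13 / 2 + k) * N `^ (k * 2%:R + (411 / 32 + k * 2%:R))) <= z ^+ 6.
  rewrite /z !powRXp // -!powRDp // ler_powR // /k; lra.
set X1 := N `^ 12%:R in b1 b2 *.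
apply: (@le_trans _ _ (X1 * (c3 * N `^ (13 / 2 + k) *
   (3 * (N `^ (9 / 8)) ^+ 2 * E ^+ 2 + 96 * (J ^+ 2 * (CY * H ^+ 2) *
     N `^ (k * 2%:R + (411 / 32 + k * 2%:R))))))).
  rewrite ler_wpM2l ?powR_ge0 //; apply: ler_pM => //.
    by apply: addr_ge0; [rewrite !mulr_ge0 ?sqr_ge0|apply: mulr_ge0 => //; exact: mulr_ge0 (sqr_ge0 _) Y0].
  by rewrite lerD2l ler_wpM2l.
move: b1 b2; set x2 := N `^ (13 / 2 + k); set x3 := N `^ (9 / 8) ^+ 2.
set x4 := N `^ (k * 2%:R + _) => b1 b2.
have m1 := ler_wpM2l (mulr_ge0 c30 E20) b1.
have m2 := ler_wpM2l q0 b2.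
have z40 : 0 <= z ^+ 4 * E ^+ 2 by rewrite mulr_ge0 // exprn_ge0 // ltW.
have z60 : 0 <= z ^+ 6 by rewrite exprn_ge0 // ltW.
have m3 := mulr_ge0 q0 z40.
have m4 := mulr_ge0 c30 z60.
move: m1 m2 m3 m4 z40 z60; rewrite /c4.
move: (z ^+ 4) (z ^+ 6) (E ^+ 2) (c3) (J ^+ 2) (CY) (H ^+ 2) => *; lra.
Qed.


Local Open Scope fset_scope.
Local Open Scope ring_scope.

(** * Induction on the number of summands *)

Lemma eta_succ (R : realType) (s : nat) : (3 < s)%N -> eta_s R s.+1 = eta_s R s / 2.
Proof.
move=> s3; rewrite /eta_s (gtn_eqF s3) (gtn_eqF (ltnW s3 : 3 < s.+1)%N).
rewrite -[RHS]mulrA; congr (_ * _).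
have -> : - s.+1%:Z + 4 = - s%:Z + 4 + (- 1) by rewrite -addn1 PoszD; ring.
by rewrite expfzDr ?pnatr_eq0 // exprN1.
Qed.

Lemma eta_bounds (R : realType) (s : nat) : (3 < s)%N -> 0 <= eta_s R s <= 1 / 4.
Proof.
elim: s => // s IH; rewrite ltnS leq_eqVlt => /orP[/eqP <-|s3].
  rewrite /eta_s /= addNr expr0z mulr1.
  have : 4 <= 7246 :> R by rewrite ler_nat.
  set t : R := 7246 => t4.
  have tp : 0 < t by lra.
  have : 0 <= 1 / t by rewrite divr_ge0 // ltW.
  have : 1 / t <= 1 / 4 by rewrite !mul1r lef_pV2 ?posrE.
  by move=> ? ?; apply/andP; split; lra.
by have /andP[h1 h2] := IH s3; rewrite eta_succ //; apply/andP; split; lra.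
Qed.

Lemma energy_high (R : realType) (d s : nat) : (1 < d)%N -> (3 < s)%N ->
  exists2 K : R, 0 <= K & forall (psi : {poly R}) (A : seq R),
    size psi = d.+1 -> uniq A -> (0 < size A)%N ->
    (en (ksum (pts psi A) s))%:R <= K * (size A)%:R `^ (2 * s%:R - 3 + eta_s R s).
Proof.
move=> d1; elim: s => // s IH; rewrite ltnS leq_eqVlt => /orP[/eqP <-|s3].
  have [K K0 h] := energy_four R d1; exists K => // psi A sp uA A0.
  apply: le_trans (h psi A sp uA A0) _; rewrite ler_wpM2l // ler_powR ?ler1n //.
  (* 131/25 = 5 + 1/4 - 1/100, so it is enough that 1/7246 <= 1/100. *)
  rewrite /eta_s /= addNr expr0z mulr1.
  have : 100 <= 7246 :> R by rewrite ler_nat.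
  set t : R := 7246 => t4.
  have tp : 0 < t by lra.
  have : 1 / t <= 1 / 100 by rewrite !mul1r lef_pV2 ?posrE.
  by move=> ?; lra.
have [K K0 h] := IH s3.
have /andP[e0 e1] := eta_bounds R s3.
have k2 : 0 < 1 / 2 :> R by rewrite divr_gt0.
have sE : s.+1%:R = s%:R + 1 :> R by rewrite -natr1.
have b1 : s%:R + (2 * s%:R - 3 + eta_s R s + 1) / 2 <= 2 * s.+1%:R - 3 + eta_s R s.+1.
  by rewrite eta_succ // sE; lra.
(* The logarithmic term may lose N^(1/2) because [eta_s] is at most 1. *)
have b2 : 2 * s%:R - 3 + eta_s R s + 1 + 1 / 2 <= 2 * s.+1%:R - 3 + eta_s R s.+1.
  by rewrite eta_succ // sE; lra.
have [K' K'0 h'] := step_powR d1 K0 k2 b1 b2.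
exists K' => // psi A sp uA A0; apply: h' => //; last exact: h.
by rewrite size_ksum size_map.
Qed.

Theorem theorem1p1 (R : realType) (s d : nat) (hs : (3 <= s)%N)
    (hd : (2 <= d)%N) :
  exists K : R, 0 < K /\
    forall (psi : {poly R}) (A : {fset R}),
      size psi = d.+1 -> A != fset0 ->
      (energy2 s psi A)%:R <= K * (#|` A|%:R `^ (2 * s%:R - 3 + eta_s R s)).
Proof.
have [K K0 h] : exists2 K : R, 0 <= K & forall (psi : {poly R}) (A : seq R),
    size psi = d.+1 -> uniq A -> (0 < size A)%N ->
    (en (ksum (pts psi A) s))%:R <= K * (size A)%:R `^ (2 * s%:R - 3 + eta_s R s).
  move: hs; rewrite leq_eqVlt => /orP[/eqP <-|s3]; last exact: energy_high.
  have [K K0 h] := energy_three R hd; exists K => // psi A sp uA A0.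
  have -> : 2 * 3%:R - 3 + eta_s R 3 = 7 / 2 by rewrite /eta_s /=; lra.
  exact: h.
(* [K] is only known to be nonnegative; the added 1 makes the constant positive. *)
exists (K + 1); split; first by rewrite ltr_pwDr.
move=> psi A sp A0; rewrite energy2E.
have A1 : (0 < size (enum_fset A))%N by rewrite cardfs_gt0.
apply: le_trans (h psi _ sp (fset_uniq A) A1) _.
by rewrite ler_wpM2r ?powR_ge0 // lerDl.
Qed.
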